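(* (1) If $\tilde w=t^\lambda s_1s_2$ with $\lambda=m\alpha_1+n\alpha_2$, $m,n\in\mathbb{Z}$, $2\leq m\leq n<2m-1$, then $$f_{\tilde w,\mathbb{O}}=\begin{cases}(v-v^{-1})^2,&\mathbb{O}=\mathbb{O}_{\lambda'},\ \lambda'\in D_\lambda,\\ v-v^{-1},&\mathbb{O}\in\mathbb{O}^{\leqslant}_{t^{\lambda-\alpha_1-\alpha_2}s_1}\cup\mathbb{O}'^{\leqslant}_{t^{\lambda-\alpha_1}s_2},\\ 1,&\mathbb{O}=\mathbb{O}_2,\\ 0,&\text{otherwise.}\end{cases}$$ (2) If $\tilde w=t^\lambda s_2s_1$ with $\lambda=m\alpha_1+n\alpha_2$, $m,n\in\mathbb{Z}$, $2\leq m<n<2m-1$, then $$f_{\tilde w,\mathbb{O}}=\begin{cases}(v-v^{-1})^2,&\mathbb{O}=\mathbb{O}_{\lambda'},\ \lambda'\in D'_\lambda,\\ v-v^{-1},&\mathbb{O}\in\mathbb{O}^{\leqslant}_{t^{\lambda-\alpha_2}s_1}\cup\mathbb{O}'^{\leqslant}_{t^{\lambda-\alpha_1-\alpha_2}s_2},\\ 1,&\mathbb{O}=\mathbb{O}_2,\\ 0,&\text{otherwise.}\end{cases}$$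
   Context: $W=\langle s_1,s_2\rangle$ is the finite Weyl group of type $A_2$; $\alpha_1,\alpha_2$ are the simple roots, identified with the simple coroots ($\langle\alpha_i,\alpha_i\rangle=2$, $\langle\alpha_1,\alpha_2\rangle=-1$); $Q=\mathbb{Z}\alpha_1\oplus\mathbb{Z}\alpha_2$; $P$ is the coweight lattice, $P_+$ its dominant elements; $\widetilde W=P\rtimes W$ with translations $t^\lambda$. $W_a=Q\rtimes W$ is the Coxeter group generated by $s_0=t^{\alpha_1+\alpha_2}s_1s_2s_1$, $s_1$, $s_2$; $\widetilde W=W_a\rtimes\langle\tau\rangle$ with $\tau^3=1$, $\tau s_0\tau^{-1}=s_1$, $\tau s_1\tau^{-1}=s_2$, $\tau s_2\tau^{-1}=s_0$; $\ell(w\tau^j)=\ell(w)$ for $w\in W_a$. $\mathbb{N}_+$ is the set of positive integers. Class polynomials: $\widetilde H$ is the algebra over $\mathbb{Z}[v,v^{-1}]$ with basis $T_{\tilde w}$ ($\tilde w\in\widetilde W$), $T_{\tilde x}T_{\tilde y}=T_{\tilde x\tilde y}$ if $\ell(\tilde x)+\ell(\tilde y)=\ell(\tilde x\tilde y)$, and $(T_s-v)(T_s+v^{-1})=0$ for $s\in\{s_0,s_1,s_2\}$. $[\widetilde H,\widetilde H]$ is the submodule spanned by commutators. For a conjugacy class $\mathbb{O}$ of $\widetilde W$, $\ell(\mathbb{O})$ is its minimal length and $T_{\mathbb{O}}$ is the image in $\widetilde H/[\widetilde H,\widetilde H]$ of $T_{w}$ for any minimal length $w\in\mathbb{O}$;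 by He–Nie this is well defined and the $T_{\mathbb{O}}$ form a basis. The class polynomials $f_{\tilde w,\mathbb{O}}$ are the unique coefficients with $T_{\tilde w}\equiv\sum_{\mathbb{O}}f_{\tilde w,\mathbb{O}}T_{\mathbb{O}}\bmod[\widetilde H,\widetilde H]$. Conjugacy classes of $\widetilde W$ in $W_a$: $\mathbb{O}_2=\{t^\lambda s_1s_2,\ t^\lambda s_2s_1\mid\lambda\in Q\}$; for $\lambda\in Q\cap P_+$, $\mathbb{O}_\lambda$ is the class of $t^\lambda$; for $i\in\mathbb{N}_+$, $\mathbb{C}_i=\{t^{k\alpha_1+i\alpha_2}s_1,\ t^{-i\alpha_1+k\alpha_2}s_2,\ t^{k\alpha_1+(k-i)\alpha_2}s_1s_2s_1\mid k\in\mathbb{Z}\}$, $\mathbb{C}'_i=\{t^{k\alpha_1-i\alpha_2}s_1,\ t^{i\alpha_1+k\alpha_2}s_2,\ t^{(k-i)\alpha_1+k\alpha_2}s_1s_2s_1\mid k\in\mathbb{Z}\}$. For $\lambda\in Q\cap P_+$: $\mathbb{O}^{\leqslant}_{t^\lambda s_1}$ is the set of all $\mathbb{C}_i$ ($i\in\mathbb{N}_+$) with $\ell(\mathbb{C}_i)\leq\ell$ of the conjugacy class of $t^\lambda s_1$; $\mathbb{O}'^{\leqslant}_{t^\lambda s_2}$ is the set of all $\mathbb{C}'_i$ with $\ell(\mathbb{C}'_i)\leq\ell$ of the conjugacy class of $t^\lambda s_2$. $Q_{sh}=Q\setminus\{k(\alpha_1+2\alpha_2),k(2\alpha_1+\alpha_2),k(\alpha_1-\alpha_2)\mid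 k\in\mathbb{Z}\}$. Write $\lambda'<\mu$ if $\mu-\lambda'$ is a nonzero combination of $\alpha_1,\alpha_2$ with nonnegative integer coefficients. For $\lambda\in Q\cap P_+$, $D_\lambda=\{\lambda'\in Q\cap P_+\mid\lambda'<\lambda-\alpha_1,\ \lambda'\neq\lambda-i\alpha_1\ \forall i\in\mathbb{N}_+\}\cap Q_{sh}$ and $D'_\lambda=\{\lambda'\in Q\cap P_+\mid\lambda'<\lambda-\alpha_2,\ \lambda'\neq\lambda-i\alpha_2\ \forall i\in\mathbb{N}_+\}\cap Q_{sh}$. *)

(* Defs.v *)
From HB Require Import structures.
From mathcomp Require Import all_boot all_order all_algebra all_fingroup.
From mathcomp Require Import boolp classical_sets functions cardinality fsbigop.
From mathcomp Require Import ring.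

Set Implicit Arguments.
Unset Strict Implicit.
Unset Printing Implicit Defensive.

Import Order.TTheory GRing.Theory Num.Theory.
Local Open Scope classical_set_scope.
Local Open Scope ring_scope.

(* The pair (a, b) stands for a omega_1 + b omega_2 in the basis of fundamental
   coweights: a and b are its pairings with alpha_1 and alpha_2. *)
Notation coweight := (int * int)%type.

Definition omega1 : coweight := (1, 0).
Definition omega2 : coweight := (0, 1).
Definition alpha1 : coweight := (2, -1).
Definition alpha2 : coweight := (-1, 2).

Definition root_lattice : set coweight :=
  [set x | exists k l : int, x = alpha1 *~ k + alpha2 *~ l].

Definition dominant : set coweight := [set x | 0 <= x.1 /\ 0 <= x.2].

(* The finite Weyl group is 'S_3, permuting the coordinates of Z^3 / Z(1,1,1).
   The coweight x lifts to (x.1 + x.2, x.2, 0), and (a0, a1, a2) has pairings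
   a0 - a1 and a1 - a2 with the simple roots.  Products in 'S_3 compose from
   left to right, so reading coordinates at w i gives a left action. *)
Definition coord (x : coweight) (i : 'I_3) : int :=
  nth 0 [:: x.1 + x.2; x.2; 0] i.

Definition i0 : 'I_3 := inord 0.
Definition i1 : 'I_3 := inord 1.
Definition i2 : 'I_3 := inord 2.

Definition wact (w : 'S_3) (x : coweight) : coweight :=
  (coord x (w i0) - coord x (w i1), coord x (w i1) - coord x (w i2)).

Lemma ord3P (i : 'I_3) : [\/ i = i0, i = i1 | i = i2].
Proof.
by case: i => [[|[|[|//]]] h]; [constructor 1|constructor 2|constructor 3];
  apply/val_inj; rewrite /= inordK.
Qed.

Lemma coord_i0 x : coord x i0 = x.1 + x.2. Proof. by rewrite /coord inordK. Qed.
Lemma coord_i1 x : coord x i1 = x.2. Proof. by rewrite /coord inordK. Qed.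
Lemma coord_i2 x : coord x i2 = 0. Proof. by rewrite /coord inordK. Qed.
Definition coordE := (coord_i0, coord_i1, coord_i2).

Lemma coord_wact w x i j :
  coord (wact w x) i - coord (wact w x) j = coord x (w i) - coord x (w j).
Proof.
by case: (ord3P i) => ->; case: (ord3P j) => ->; rewrite !coordE /=; ring.
Qed.

Lemma wact1 x : wact 1%g x = x.
Proof. by case: x => a b; rewrite /wact !perm1 !coordE /=; congr pair; ring. Qed.

Lemma wactM u w x : wact (u * w)%g x = wact u (wact w x).
Proof. by rewrite [in RHS]/wact !coord_wact /wact !permM. Qed.

Lemma wactD w x y : wact w (x + y) = wact w x + wact w y.
Proof.
have cD i : coord (x + y) i = coord x i + coord y i.
  by case: (ord3P i) => ->; rewrite !coordE /=; ring.
by rewrite /wact !cD; congr pair => /=; ring.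
Qed.

Lemma wact0 w : wact w 0 = 0.
Proof. by apply: (addrI (wact w 0)); rewrite -wactD !addr0. Qed.

Lemma wactN w x : wact w (- x) = - wact w x.
Proof. by apply: (addrI (wact w x)); rewrite -wactD !subrr wact0. Qed.

(* ExtAff x w is the element t^x w of the extended affine Weyl group. *)
Record extaff := ExtAff { transl : coweight; linear : 'S_3 }.

Definition pair_of_extaff (g : extaff) := (transl g, linear g).
Definition extaff_of_pair p := ExtAff p.1 p.2.
Lemma pair_of_extaffK : cancel pair_of_extaff extaff_of_pair.
Proof. by case. Qed.
HB.instance Definition _ := Choice.copy extaff (can_type pair_of_extaffK).

Definition extaff_one := ExtAff 0 1%g.
Definition extaff_mul g h :=
  ExtAff (transl g + wact (linear g) (transl h)) (linear g * linear h)%g.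
Definition extaff_inv g :=
  ExtAff (- wact (linear g)^-1%g (transl g)) (linear g)^-1%g.

Lemma extaff_mulA : associative extaff_mul.
Proof.
by move=> x y z; rewrite /extaff_mul /= wactD wactM addrA mulgA.
Qed.

Lemma extaff_mul1x : left_id extaff_one extaff_mul.
Proof. by case=> x u; rewrite /extaff_mul /= wact1 add0r mul1g. Qed.

Lemma extaff_mulx1 : right_id extaff_one extaff_mul.
Proof. by case=> x u; rewrite /extaff_mul /= wact0 addr0 mulg1. Qed.

Lemma extaff_mulVx : left_inverse extaff_one extaff_inv extaff_mul.
Proof. by case=> x u; rewrite /extaff_mul /= addNr mulVg. Qed.

Lemma extaff_mulxV : right_inverse extaff_one extaff_inv extaff_mul.
Proof.
by case=> x u; rewrite /extaff_mul /= wactN -wactM mulgV wact1 subrr.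
Qed.

HB.instance Definition _ := isGroup.Build extaff
  extaff_mulA extaff_mul1x extaff_mulx1 extaff_mulVx extaff_mulxV.

Definition tr (x : coweight) : extaff := ExtAff x 1%g.
Definition s1 : extaff := ExtAff 0 (tperm i0 i1).
Definition s2 : extaff := ExtAff 0 (tperm i1 i2).
Definition s0 : extaff := (tr (alpha1 + alpha2) * s1 * s2 * s1)%g.


Definition tau : extaff := (tr omega1 * s1 * s2)%g.

Definition simple (i : 'I_3) : extaff := nth 1%g [:: s0; s1; s2] i.


Lemma i_neq : (i0 != i1) * (i0 != i2) * (i1 != i2).
Proof. by rewrite -!val_eqE /= !inordK. Qed.

Lemma extaffP (g h : extaff) :
    transl g = transl h -> linear g i0 = linear h i0 ->
  linear g i1 = linear h i1 -> g = h.
Proof.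
case: g h => [x u] [y w] /= -> e0 e1; congr ExtAff.
have perm_neq (p : 'S_3) i j : i != j -> p i != p j by rewrite (inj_eq perm_inj).
have e2 : u i2 = w i2.
  move: (perm_neq u _ _ i_neq.1.1) (perm_neq u _ _ i_neq.1.2) (perm_neq u _ _ i_neq.2).
  move: (perm_neq w _ _ i_neq.1.1) (perm_neq w _ _ i_neq.1.2) (perm_neq w _ _ i_neq.2).
  rewrite e0 e1; case: (ord3P (w i0)) => ->; case: (ord3P (w i1)) => ->;
    case: (ord3P (w i2)) => ->; case: (ord3P (u i2)) => ->;
    by rewrite ?eqxx.
by apply/permP => i; case: (ord3P i) => ->.
Qed.

Lemma tpermE3 :
  ((tperm i0 i1 i0 = i1) * (tperm i0 i1 i1 = i0) * (tperm i0 i1 i2 = i2)) *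
  ((tperm i1 i2 i0 = i0) * (tperm i1 i2 i1 = i2) * (tperm i1 i2 i2 = i1)).
Proof.
by rewrite !tpermL !tpermR !tpermD // 1?eq_sym ?i_neq // eq_sym i_neq.
Qed.

Lemma mulrz_coweight (x : coweight) (k : int) : x *~ k = (x.1 * k, x.2 * k).
Proof.
have Mn (y : coweight) n : y *+ n = (y.1 *+ n, y.2 *+ n).
  by elim: n => [|n IH]; rewrite ?mulr0n // !mulrS IH.
have Mz (a : int) n : a *+ n = a * n%:Z by rewrite -mulr_natr natz.
case: k => n; first by rewrite -pmulrn Mn !Mz.
by rewrite NegzE mulrNz -pmulrn Mn !Mz !mulrN.
Qed.

Lemma wact_s1 x : wact (linear s1) x = x - alpha1 *~ x.1.
Proof.
by rewrite /wact /= !tpermE3 !coordE mulrz_coweight; congr pair => /=; ring.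
Qed.

Lemma wact_s2 x : wact (linear s2) x = x - alpha2 *~ x.2.
Proof.
by rewrite /wact /= !tpermE3 !coordE mulrz_coweight; congr pair => /=; ring.
Qed.

Lemma extaff_mulE (g h : extaff) : (g * h)%g = extaff_mul g h.
Proof. by []. Qed.

Ltac extaff_compute :=
  apply: extaffP; rewrite /= /wact ?(permM, perm1, tpermE3) //= ?coordE; by [].

Lemma s1K : (s1 * s1 = 1)%g. Proof. extaff_compute. Qed.
Lemma s2K : (s2 * s2 = 1)%g. Proof. extaff_compute. Qed.
Lemma s0K : (s0 * s0 = 1)%g. Proof. by rewrite /s0 !mulgA; extaff_compute. Qed.
Lemma tau3 : (tau * tau * tau = 1)%g. Proof. extaff_compute. Qed.
Lemma tau_s0 : (tau * s0 = s1 * tau)%g. Proof. extaff_compute. Qed.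
Lemma tau_s1 : (tau * s1 = s2 * tau)%g. Proof. extaff_compute. Qed.
Lemma tau_s2 : (tau * s2 = s0 * tau)%g. Proof. extaff_compute. Qed.

Lemma tauP : [/\ (tau ^+ 3 = 1)%g, (tau * s0 * tau^-1 = s1)%g,
  (tau * s1 * tau^-1 = s2)%g & (tau * s2 * tau^-1 = s0)%g].
Proof.
by rewrite tau_s0 tau_s1 tau_s2 !mulgK; split; rewrite // -tau3 !expgS mulg1 mulgA.
Qed.

Definition is_word (g : extaff) (n : nat) : bool :=
  [exists u : n.-tuple 'I_3, [exists j : 'I_3,
     g == ((\prod_(i <- u) simple i) * tau ^+ j)%g]].

Section WordExists.

Let reach g := exists (u : seq 'I_3) j, g = ((\prod_(i <- u) simple i) * tau ^+ j)%g.

Let reach1 : reach 1%g.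
Proof. by exists [::], 0%N; rewrite big_nil mulg1. Qed.

Let reach_tau g : reach g -> reach (g * tau)%g.
Proof. by move=> [u [j ->]]; exists u, j.+1; rewrite expgSr (mulgA _ _ tau). Qed.

Let tau_simple i : exists k, (tau * simple i = simple k * tau)%g.
Proof.
case: (ord3P i) => ->; [exists i1|exists i2|exists i0];
  rewrite /simple !inordK //=; [exact: tau_s0|exact: tau_s1|exact: tau_s2].
Qed.

Let reach_simple g i : reach g -> reach (g * simple i)%g.
Proof.
move=> [u [j ->]].
have [k ek] : exists k, (tau ^+ j * simple i = simple k * tau ^+ j)%g.
  elim: j => [|j [k IH]]; first by exists i; rewrite mulg1 mul1g.
  have [l el] := tau_simple k; exists l.
  by rewrite expgS -(mulgA tau) IH (mulgA tau) el (mulgA _ tau).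
by exists (rcons u k), j; rewrite big_rcons -mulgA ek mulgA.
Qed.

Let reach_s g : reach g ->
  [/\ reach (g * s0)%g, reach (g * s1)%g & reach (g * s2)%g].
Proof.
move=> rg; split;
  [have := reach_simple i0 rg|have := reach_simple i1 rg|have := reach_simple i2 rg];
  by rewrite /simple inordK.
Qed.

Let reachM g h : reach g -> reach h -> reach (g * h)%g.
Proof.
move=> rg [u [j ->]]; rewrite mulgA.
elim: j => [|j IH]; last by rewrite expgSr (mulgA _ _ tau); apply: reach_tau.
rewrite mulg1; elim/last_ind: u => [|u i IH]; first by rewrite big_nil mulg1.
by rewrite big_rcons mulgA; apply: reach_simple.
Qed.

Let reach_tr x : reach (tr x).
Proof.
have trD (y z : coweight) : tr (y + z) = (tr y * tr z)%g.
  by rewrite [RHS]extaff_mulE /extaff_mul /= wact1 mulg1.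
have tr0 : tr 0 = 1%g by [].
have rw1 : reach (tr omega1).
  have -> : tr omega1 = (1 * tau * s2 * s1)%g by extaff_compute.
  by have [_ _ /reach_s[_ + _]] := reach_s (reach_tau reach1).
have rw2 : reach (tr omega2).
  have -> : tr omega2 = (1 * tau * tau * s1 * s2)%g by extaff_compute.
  by have [_ /reach_s[_ _ +] _] := reach_s (reach_tau (reach_tau reach1)).
have rw1N : reach (tr (- omega1)).
  have -> : tr (- omega1) = (1 * s1 * s2 * tau * tau)%g by extaff_compute.
  have [_ /reach_s[_ _ h] _] := reach_s reach1.
  by apply: reach_tau; apply: reach_tau.
have rw2N : reach (tr (- omega2)).
  have -> : tr (- omega2) = (1 * s2 * s1 * tau)%g by extaff_compute.
  have [_ _ /reach_s[_ h _]] := reach_s reach1.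
  by apply: reach_tau.
have rz y (k : int) : reach (tr y) -> reach (tr (- y)) -> reach (tr (y *~ k)).
  move=> ry rNy; case: k => n.
    by elim: n => [|n IH] //; rewrite -pmulrn mulrS trD; apply: reachM.
  rewrite NegzE mulrNz -mulNrz -pmulrn.
  by elim: n => [|n IH] //; rewrite mulrS trD; apply: reachM.
have -> : x = omega1 *~ x.1 + omega2 *~ x.2.
  by case: x => a b; rewrite !mulrz_coweight; congr pair => /=; ring.
by rewrite trD; apply: reachM; apply: rz.
Qed.

Let reach_all g : reach g.
Proof.
have -> : g = (tr (transl g) * ExtAff 0 (linear g))%g.
  by case: g => x u; rewrite [RHS]extaff_mulE /extaff_mul /= wact0 addr0 mul1g.
apply: reachM => //; move: (linear g) => {g} u.
have [_ r1 r2] := reach_s reach1.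
have [_ _ r12] := reach_s r1; have [_ r21 _] := reach_s r2.
have [_ r121 _] := reach_s r12.
have ne (i j : 'I_3) : i != j -> u i != u j by rewrite (inj_eq perm_inj).
move: (ne _ _ i_neq.1.1) => {ne}.
case: (ord3P (u i0)) => e0; case: (ord3P (u i1)) => e1; rewrite e0 e1 ?eqxx // => _.
- suff -> : ExtAff 0 u = 1%g by exact: reach1.
  by apply: extaffP; rewrite /= ?perm1 ?e0 ?e1.
- suff -> : ExtAff 0 u = (1 * s2)%g by [].
  by apply: extaffP; rewrite /= ?wact0 ?(permM, perm1, tpermE3, e0, e1).
- suff -> : ExtAff 0 u = (1 * s1)%g by [].
  by apply: extaffP; rewrite /= ?wact0 ?(permM, perm1, tpermE3, e0, e1).
- suff -> : ExtAff 0 u = (1 * s2 * s1)%g by [].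
  by apply: extaffP; rewrite /= ?wact0 ?(permM, perm1, tpermE3, e0, e1).
- suff -> : ExtAff 0 u = (1 * s1 * s2)%g by [].
  by apply: extaffP; rewrite /= ?wact0 ?(permM, perm1, tpermE3, e0, e1).
- suff -> : ExtAff 0 u = (1 * s1 * s2 * s1)%g by [].
  by apply: extaffP; rewrite /= ?wact0 ?(permM, perm1, tpermE3, e0, e1).
Qed.

Lemma word_exists g : exists n, is_word g n.
Proof.
have [u [j ->]] := reach_all g.
exists (size u); apply/existsP; exists (in_tuple u).
apply/existsP; exists (inord (j %% 3)).
have t3 : (tau ^+ 3 = 1)%g by have [] := tauP.
by rewrite inordK ?ltn_pmod // {1}(divn_eq j 3) expgD mulnC expgM t3 expg1n mul1g.
Qed.

End WordExists.

(* The length of w tau^j, w in the affine Weyl group, is the Coxeter length of w. *)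
Definition len (g : extaff) : nat := ex_minn (word_exists g).

(* Z[v, v^-1], as the subring of Q(v) of elements p / v^n with p in Z[v]. *)
Local Notation "p %:F" := (@FracField.tofrac _ p).

Definition is_laurent (x : {fraction {poly int}}) : bool :=
  `[< exists (p : {poly int}) (n : nat), x * 'X%:F ^+ n = p%:F >].

Lemma is_laurent_subring : GRing.subring_closed is_laurent.
Proof.
split.
- by apply/asboolP; exists 1, 0%N; rewrite expr0 mulr1 tofrac1.
- move=> x y /asboolP[p [m xp]] /asboolP[q [n yq]]; apply/asboolP.
  exists (p * 'X^n - q * 'X^m), (m + n)%N.
  rewrite tofracB !tofracM !tofracXn -xp -yq mulrBl exprD.
  by congr (_ - _); rewrite ?mulrA // -!mulrA [X in _ * X]mulrC.
- move=> x y /asboolP[p [m xp]] /asboolP[q [n yq]]; apply/asboolP.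
  exists (p * q), (m + n)%N.
  by rewrite tofracM -xp -yq exprD mulrACA.
Qed.

HB.instance Definition _ :=
  GRing.isSubringClosed.Build _ is_laurent is_laurent_subring.

Record laurent := Laurent {
  laurent_val : {fraction {poly int}};
  laurent_valP : is_laurent laurent_val }.
HB.instance Definition _ := [isSub for laurent_val].
HB.instance Definition _ := [Choice of laurent by <:].
HB.instance Definition _ := [SubChoice_isSubComNzRing of laurent by <:].

Lemma tofracX_neq0 : ('X : {poly int})%:F != 0.
Proof. by rewrite tofrac_eq0 polyX_eq0. Qed.

Lemma is_laurent_v : is_laurent 'X%:F.
Proof. by apply/asboolP; exists 'X, 0%N; rewrite mulr1. Qed.

Lemma is_laurent_vinv : is_laurent ('X%:F)^-1.
Proof.
by apply/asboolP; exists 1, 1%N; rewrite expr1 mulVf ?tofracX_neq0 // tofrac1.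
Qed.

Definition v : laurent := Laurent is_laurent_v.
Definition vinv : laurent := Laurent is_laurent_vinv.

Lemma v_vinv : v * vinv = 1.
Proof. by apply: val_inj; rewrite rmorphM rmorph1 /= divff ?tofracX_neq0. Qed.

Definition is_basis (M : lmodType laurent) (T : extaff -> M) : Prop :=
  (forall h : M, exists (s : seq extaff) (c : extaff -> laurent),
     h = \sum_(g <- s) c g *: T g) /\
  (forall (s : seq extaff) (c : extaff -> laurent), uniq s ->
     \sum_(g <- s) c g *: T g = 0 -> forall g, g \in s -> c g = 0).

(* These axioms determine the pair (H, T) up to a unique isomorphism. *)
Record is_hecke_algebra (H : algType laurent) (T : extaff -> H) : Prop := {
  hecke_basis : is_basis T;
  hecke_mul : forall g h : extaff,
    (len g + len h)%N = len (g * h)%g -> T g * T h = T (g * h)%g;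
  hecke_quadratic : forall i : 'I_3,
    (T (simple i) - v%:A) * (T (simple i) + vinv%:A) = 0 }.

Definition commutator_span (H : algType laurent) : set H :=
  [set h | exists s : seq (laurent * (H * H)),
     h = \sum_(p <- s) p.1 *: (p.2.1 * p.2.2 - p.2.2 * p.2.1)].

Definition conj_class (g : extaff) : set extaff :=
  range (fun x : extaff => (x^-1 * g * x)%g).

Definition conj_classes : set (set extaff) := range conj_class.

Definition min_length_elts (O : set extaff) : set extaff :=
  [set g | O g /\ forall h, O h -> (len g <= len h)%N].

Definition class_len (O : set extaff) : nat :=
  len (xget 1%g (min_length_elts O)).

(* f is the family of class polynomials of g.  Only its values on conjugacy
   classes matter; rep chooses the minimal length element representing T_O. *)
Definition class_polynomials (H : algType laurent) (T : extaff -> H)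
    (g : extaff) (f : set extaff -> laurent) : Prop :=
  finite_set [set O | conj_classes O /\ f O <> 0] /\
  forall rep : set extaff -> extaff,
    (forall O, conj_classes O -> min_length_elts O (rep O)) ->
    commutator_span (T g - \sum_(O \in conj_classes) f O *: T (rep O)).

Definition O_2 : set extaff :=
  [set g | exists2 x, root_lattice x &
     g = (tr x * s1 * s2)%g \/ g = (tr x * s2 * s1)%g].

Definition O_tr (x : coweight) : set extaff := conj_class (tr x).

Definition C_ (i : nat) : set extaff :=
  [set g | exists k : int,
     [\/ g = (tr (alpha1 *~ k + alpha2 *~ i) * s1)%g,
         g = (tr (alpha1 *~ (- i%:Z) + alpha2 *~ k) * s2)%g
       | g = (tr (alpha1 *~ k + alpha2 *~ (k - i%:Z)) * s1 * s2 * s1)%g]].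

Definition C'_ (i : nat) : set extaff :=
  [set g | exists k : int,
     [\/ g = (tr (alpha1 *~ k + alpha2 *~ (- i%:Z)) * s1)%g,
         g = (tr (alpha1 *~ i + alpha2 *~ k) * s2)%g
       | g = (tr (alpha1 *~ (k - i%:Z) + alpha2 *~ k) * s1 * s2 * s1)%g]].

Definition C_le (x : coweight) : set (set extaff) :=
  [set O | exists i : nat, [/\ (0 < i)%N, O = C_ i &
     (class_len (C_ i) <= class_len (conj_class (tr x * s1)%g))%N]].

Definition C'_le (x : coweight) : set (set extaff) :=
  [set O | exists i : nat, [/\ (0 < i)%N, O = C'_ i &
     (class_len (C'_ i) <= class_len (conj_class (tr x * s2)%g))%N]].

Definition Q_sh : set coweight :=
  root_lattice `\` [set x | exists k : int,
    [\/ x = (alpha1 + alpha2 *+ 2) *~ k,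
        x = (alpha1 *+ 2 + alpha2) *~ k
      | x = (alpha1 - alpha2) *~ k]].

Definition root_lt (x y : coweight) : Prop :=
  exists a b : nat, (a, b) <> (0%N, 0%N) /\ y - x = alpha1 *+ a + alpha2 *+ b.

Definition D_ (x : coweight) : set coweight :=
  [set y | [/\ root_lattice y, dominant y, root_lt y (x - alpha1) &
     forall i : nat, (0 < i)%N -> y <> x - alpha1 *+ i]] `&` Q_sh.

Definition D'_ (x : coweight) : set coweight :=
  [set y | [/\ root_lattice y, dominant y, root_lt y (x - alpha2) &
     forall i : nat, (0 < i)%N -> y <> x - alpha2 *+ i]] `&` Q_sh.

(* Main.v *)
(* Conjugating by s0 gives, for lambda = (a, b) in the basis of fundamental
   coweights with a >= 2,
     T[t^lambda s1 s2] = T[t^(lambda - alpha1) s1 s2] + q T[t^(1 - b, 1 - a) s1]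
   modulo commutators, with q = v - v^-1 (and s2 s1 instead of s1 s2 when
   a = 2), and symmetrically for s2 s1 and alpha2.  The reflection terms reduce
   similarly, each step by alpha2 splitting off q T_O for a regular translation
   class O.  An induction on a + b then produces the coefficients, and both
   parts of the statement turn out to have the same right-hand side.
   Uniqueness of the class polynomials is the linear independence of the T_O
   modulo commutators.  It is tested by trace functions coming from the
   principal series, from the representations induced from a Levi subgroup of
   type A_1, and from characters.  At v = 1 these traces count fixed points and
   separate the conjugacy classes, so the coefficients of a relation are divisible
   by v - 1; since Z[v, v^-1] is a domain, one can divide and repeat. *)
Require Import Defs.
From HB Require Import structures.
From mathcomp Require Import all_boot all_order all_algebra all_fingroup.
From mathcomp Require Import boolp classical_sets functions cardinality fsbigop.
From mathcomp Require Import ring zify.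

Set Implicit Arguments.
Unset Strict Implicit.
Unset Printing Implicit Defensive.

Import Order.TTheory GRing.Theory Num.Theory.
Local Open Scope classical_set_scope.
Local Open Scope ring_scope.

(** * Coordinates and lengths *)

(** [H] is known only through a basis and the products of length-additive pairs, so a trace has to
    be given by its values on the basis, and it is tested against the simple reflections and [tau].
    Representations are therefore built on functions on a set, from operators satisfying the
    quadratic and braid relations; Matsumoto's theorem then attaches an operator to each group
    element.

    The theorem of He and Nie is not proved in general. Existence requires only that minimal length
    elements agree modulo commutators in the classes that occur in the expansions, and uniqueness
    requires a single choice of representatives.

    Coefficients are written as functions of a numerical class invariant, and lambda = (a, b) enters
    them only through 2a + b and a + 2b. Subtracting alpha1 lowers only the first number,
    subtracting alpha2 only the second, each by 3, so every step of the recursion moves one bound of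
    a range. *)

Variant weyl := We | W1 | W2 | W12 | W21 | W121.
Variant node := N0 | N1 | N2.

Definition weyl_code u : nat :=
  match u with We => 0 | W1 => 1 | W2 => 2 | W12 => 3 | W21 => 4 | W121 => 5 end.
Definition weyl_decode n : weyl :=
  match n with 0 => We | 1 => W1 | 2 => W2 | 3 => W12 | 4 => W21 | _ => W121 end.
Lemma weyl_codeK : cancel weyl_code weyl_decode. Proof. by case. Qed.
HB.instance Definition _ := Equality.copy weyl (can_type weyl_codeK).

Definition node_code i : nat := match i with N0 => 0 | N1 => 1 | N2 => 2 end.
Definition node_decode n := match n with 0 => N0 | 1 => N1 | _ => N2 end.
Lemma node_codeK : cancel node_code node_decode. Proof. by case. Qed.
HB.instance Definition _ := Equality.copy node (can_type node_codeK).

(** Permutations in ['S_3] do not reduce by computation. With six named elements and explicit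
    tables, identities in the extended group become finite case splits closed by linear
    arithmetic. *)
Definition wperm (u : weyl) : 'S_3 :=
  match u with
  | We => 1%g
  | W1 => tperm i0 i1
  | W2 => tperm i1 i2
  | W12 => (tperm i0 i1 * tperm i1 i2)%g
  | W21 => (tperm i1 i2 * tperm i0 i1)%g
  | W121 => (tperm i0 i1 * tperm i1 i2 * tperm i0 i1)%g
  end.

Definition mk (u : weyl) (a b : int) : extaff := ExtAff (a, b) (wperm u).

Definition sgen (i : node) : extaff :=
  match i with N0 => s0 | N1 => s1 | N2 => s2 end.

(* In these tables [N0] stands for the finite part s1 s2 s1 of s0. *)
Definition wmulL (i : node) (u : weyl) : weyl :=
  match i, u with
  | N1, We => W1 | N1, W1 => We | N1, W2 => W12 | N1, W12 => W2
  | N1, W21 => W121 | N1, W121 => W21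
  | N2, We => W2 | N2, W2 => We | N2, W1 => W21 | N2, W21 => W1
  | N2, W12 => W121 | N2, W121 => W12
  | N0, We => W121 | N0, W121 => We | N0, W1 => W12 | N0, W12 => W1
  | N0, W2 => W21 | N0, W21 => W2
  end.

Definition wmulR (u : weyl) (i : node) : weyl :=
  match i, u with
  | N1, We => W1 | N1, W1 => We | N1, W2 => W21 | N1, W21 => W2
  | N1, W12 => W121 | N1, W121 => W12
  | N2, We => W2 | N2, W2 => We | N2, W1 => W12 | N2, W12 => W1
  | N2, W21 => W121 | N2, W121 => W21
  | N0, We => W121 | N0, W121 => We | N0, W1 => W21 | N0, W21 => W1
  | N0, W2 => W12 | N0, W12 => W2
  end.

(** Left multiplication by s1 s2, the finite part of [tau]; [wrotR] is right multiplication by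
    it. *)
Definition wrot (u : weyl) : weyl :=
  match u with
  | We => W12 | W12 => W21 | W21 => We | W1 => W121 | W121 => W2 | W2 => W1
  end.

Definition wrotR (u : weyl) : weyl :=
  match u with
  | We => W12 | W12 => W21 | W21 => We | W1 => W2 | W2 => W121 | W121 => W1
  end.

(** This is u(alpha1 + alpha2), the translation that right multiplication by s0 adds to t^x u;
    likewise [womega] is u(omega1), added by [tau]. *)
Definition wtheta (u : weyl) : coweight :=
  match u with
  | We => (1, 1) | W1 => (-1, 2) | W2 => (2, -1) | W12 => (-2, 1)
  | W21 => (1, -2) | W121 => (-1, -1)
  end.

Definition womega (u : weyl) : coweight :=
  match u with
  | We => (1, 0) | W1 => (-1, 1) | W2 => (1, 0) | W12 => (-1, 1)
  | W21 => (0, -1) | W121 => (0, -1)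
  end.

Definition lmul (i : node) (e : weyl * (int * int)) : weyl * (int * int) :=
  let: (u, (a, b)) := e in
  match i with
  | N0 => (wmulL N0 u, (1 - b, 1 - a))
  | N1 => (wmulL N1 u, (- a, a + b))
  | N2 => (wmulL N2 u, (a + b, - b))
  end.

Definition rmul (e : weyl * (int * int)) (i : node) : weyl * (int * int) :=
  let: (u, (a, b)) := e in
  match i with
  | N0 => (wmulR u N0, (a + (wtheta u).1, b + (wtheta u).2))
  | _ => (wmulR u i, (a, b))
  end.

Definition enc (e : weyl * (int * int)) : extaff := mk e.1 e.2.1 e.2.2.

Definition ltau (e : weyl * (int * int)) : weyl * (int * int) :=
  let: (u, (a, b)) := e in (wrot u, (1 - a - b, a)).

Definition rtau (e : weyl * (int * int)) : weyl * (int * int) :=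
  let: (u, (a, b)) := e in (wrotR u, (a + (womega u).1, b + (womega u).2)).

Lemma coweight_ext (x y : coweight) : x.1 = y.1 -> x.2 = y.2 -> x = y.
Proof. by case: x y => a b [c d] /= -> ->. Qed.

Ltac elt_compute :=
  rewrite /enc /= ?extaff_mulE; apply: extaffP;
  rewrite /= /wact ?(permM, perm1, tpermE3) ?coordE /=;
  by [|apply: coweight_ext => /=; lia].

Lemma mk_lmul i u a b : (sgen i * mk u a b)%g = enc (lmul i (u, (a, b))).
Proof. by case: i; case: u; elt_compute. Qed.

Lemma mk_rmul i u a b : (mk u a b * sgen i)%g = enc (rmul (u, (a, b)) i).
Proof. by case: i; case: u; elt_compute. Qed.

Lemma mk_ltau u a b : (tau * mk u a b)%g = enc (ltau (u, (a, b))).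
Proof. by case: u; elt_compute. Qed.

Lemma mk_rtau u a b : (mk u a b * tau)%g = enc (rtau (u, (a, b))).
Proof. by case: u; elt_compute. Qed.

Lemma wperm_surj (p : 'S_3) : exists u, p = wperm u.
Proof.
have pP (u : weyl) : p i0 = wperm u i0 -> p i1 = wperm u i1 -> exists u, p = wperm u.
  by move=> h0 h1; exists u; have [] := @extaffP (ExtAff 0 p) (ExtAff 0 (wperm u)) erefl h0 h1.
have ne : p i0 != p i1 by rewrite (inj_eq perm_inj) i_neq.
move: ne (pP We) (pP W1) (pP W2) (pP W12) (pP W21) (pP W121).
rewrite /= ?(permM, perm1, tpermE3).
by case: (ord3P (p i0)) => ->; case: (ord3P (p i1)) => ->; rewrite ?eqxx //; auto.
Qed.

Lemma wperm_inj : injective wperm.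
Proof.
have [[n01 n02] n12] := i_neq.
move=> u w /permP e; move: (e i0) (e i1) => {e}.
by case: u; case: w; rewrite /= ?(permM, perm1, tpermE3) // => h h';
  move: n01 n02 n12; rewrite ?h ?h' ?eqxx // -?h -?h' ?eqxx.
Qed.

Lemma enc_inj : injective enc.
Proof.
by case=> u [a b]; case=> w [c d]; rewrite /enc /mk /= => -[-> -> /wperm_inj ->].
Qed.

Lemma enc_surj g : exists e, enc e = g.
Proof.
by case: g => [[a b] p]; have [u ->] := wperm_surj p; exists (u, (a, b)).
Qed.

Definition dec (g : extaff) : weyl * (int * int) := projT1 (cid (enc_surj g)).

Lemma decK : cancel dec enc.
Proof. by move=> g; rewrite /dec; case: cid. Qed.

Lemma encK : cancel enc dec.
Proof. by move=> e; apply: enc_inj; rewrite decK. Qed.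

Lemma enc_lmul i e : (sgen i * enc e)%g = enc (lmul i e).
Proof. by case: e => u [a b]; apply: mk_lmul. Qed.

Lemma enc_rmul e i : (enc e * sgen i)%g = enc (rmul e i).
Proof. by case: e => u [a b]; apply: mk_rmul. Qed.

Lemma enc_ltau e : (tau * enc e)%g = enc (ltau e).
Proof. by case: e => u [a b]; apply: mk_ltau. Qed.

Lemma enc_rtau e : (enc e * tau)%g = enc (rtau e).
Proof. by case: e => u [a b]; apply: mk_rtau. Qed.

Lemma enc1 : enc (We, (0, 0)) = 1%g. Proof. by []. Qed.

Lemma simple_sgen i : exists k, simple i = sgen k.
Proof.
by case: (ord3P i) => ->; [exists N0|exists N1|exists N2]; rewrite /simple inordK.
Qed.

Lemma sgen_simple k : exists i, sgen k = simple i.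
Proof.
by case: k; [exists i0|exists i1|exists i2]; rewrite /simple inordK.
Qed.

Lemma sgenK i : (sgen i * sgen i)%g = 1%g.
Proof. by case: i; [exact: s0K|exact: s1K|exact: s2K]. Qed.

Lemma sgenV i : ((sgen i)^-1 = sgen i)%g.
Proof. by apply: (mulgI (sgen i)); rewrite mulgV sgenK. Qed.

Lemma lmulK i : involutive (lmul i).
Proof. by move=> e; apply: enc_inj; rewrite -!enc_lmul mulgA sgenK mul1g. Qed.

Lemma rmulK i : involutive (rmul^~ i).
Proof. by move=> e; apply: enc_inj; rewrite -!enc_rmul -mulgA sgenK mulg1. Qed.

(* Iwahori-Matsumoto: the hyperplane direction alpha > 0 contributes
   |<x, alpha> - [u^-1 alpha < 0]| to the length of t^x u. *)
Definition wlen (e : weyl * (int * int)) : nat :=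
  let: (u, (a, b)) := e in
  match u with
  | We => absz (a)%R + absz (b)%R + absz (a + b)%R
  | W1 => absz (a - 1)%R + absz (b)%R + absz (a + b)%R
  | W2 => absz (a)%R + absz (b - 1)%R + absz (a + b)%R
  | W12 => absz (a - 1)%R + absz (b)%R + absz (a + b - 1)%R
  | W21 => absz (a)%R + absz (b - 1)%R + absz (a + b - 1)%R
  | W121 => absz (a - 1)%R + absz (b - 1)%R + absz (a + b - 1)%R
  end%N.

Lemma wlen_lmul i e : wlen (lmul i e) = (wlen e).+1 \/ wlen e = (wlen (lmul i e)).+1.
Proof. by case: e => u [a b]; case: i; case: u => /=; lia. Qed.

Lemma wlen_rmul i e : wlen (rmul e i) = (wlen e).+1 \/ wlen e = (wlen (rmul e i)).+1.
Proof. by case: e => u [a b]; case: i; case: u => /=; lia. Qed.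

Lemma wlen_ltau e : wlen (ltau e) = wlen e.
Proof. by case: e => u [a b]; case: u => /=; lia. Qed.

Lemma wlen_rtau e : wlen (rtau e) = wlen e.
Proof. by case: e => u [a b]; case: u => /=; lia. Qed.

(** If no left multiplication shortened e, its alcove would lie on the same side as the fundamental
    alcove of all three walls of the latter, hence coincide with it. *)
Lemma wlen_descent e : (0 < wlen e)%N -> exists i, wlen e = (wlen (lmul i e)).+1.
Proof.
move=> e0; apply: contrapT => no.
have up i : wlen (lmul i e) = (wlen e).+1.
  by have [//|h] := wlen_lmul i e; case: no; exists i.
move: e0 (up N0) (up N1) (up N2) => {no up}.
by case: e => u [a b]; case: u => /=; lia.
Qed.

Lemma wlen0 e : wlen e = 0%N ->
  exists2 j, (j < 3)%N & enc e = (tau ^+ j)%g.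
Proof.
have t1 : (tau ^+ 1)%g = enc (W12, (1, 0)).
  by rewrite -[LHS](mulg1 tau) (enc_ltau (We, (0, 0))).
have t2 : (tau ^+ 2)%g = enc (W21, (0, 1)).
  by rewrite expgS t1 enc_ltau.
case: e => u [a b]; case: u => /= h; try lia.
- by exists 0%N => //; congr (enc (_, (_, _))); lia.
- by exists 1%N => //; rewrite t1; congr (enc (_, (_, _))); lia.
- by exists 2 => //; rewrite t2; congr (enc (_, (_, _))); lia.
Qed.

Lemma is_wordP g n :
  reflect (exists (u : seq node) (j : nat), [/\ size u = n, (j < 3)%N
             & g = ((\prod_(i <- u) sgen i) * tau ^+ j)%g]) (is_word g n).
Proof.
apply: (iffP existsP) => [[u /existsP[j /eqP ->]]|[u [j [un j3 ->]]]].
- have : exists u' : seq node, size u' = size u /\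
      (\prod_(i <- u) simple i = \prod_(i <- u') sgen i)%g.
    elim: {u}(tval u) => [|i u [u' [su eu]]]; first by exists [::]; rewrite !big_nil.
    by have [k ek] := simple_sgen i; exists (k :: u'); rewrite /= su !big_cons eu ek.
  by case=> u' [su ->]; exists u', j; rewrite su size_tuple.
- have : exists u' : seq 'I_3, size u' = size u /\
      (\prod_(i <- u') simple i = \prod_(i <- u) sgen i)%g.
    elim: {un} u => [|i u [u' [su eu]]]; first by exists [::]; rewrite !big_nil.
    by have [k ek] := sgen_simple i; exists (k :: u'); rewrite /= su !big_cons eu ek.
  case=> u' [su eu]; have un' : size u' == n by rewrite su un.
  by exists (Tuple un'); apply/existsP; exists (Ordinal j3); rewrite eu.
Qed.

Lemma wlen_word (u : seq node) j :
  (wlen (dec ((\prod_(i <- u) sgen i) * tau ^+ j)%g) <= size u)%N.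
Proof.
elim: u => [|i u IH].
  rewrite big_nil mul1g; elim: j => [|j IH]; first by rewrite (encK (We, (0, 0))).
  by rewrite expgS -[(tau ^+ j)%g]decK enc_ltau encK wlen_ltau.
rewrite big_cons -mulgA; move: IH; set g := (_ * _)%g => IH.
by rewrite -[g]decK enc_lmul encK /=; have := wlen_lmul i (dec g); lia.
Qed.

Lemma word_wlen e : is_word (enc e) (wlen e).
Proof.
have [n] := ubnP (wlen e); elim: n e => // n IH e en.
have [e0|e0] := posnP (wlen e).
  apply/is_wordP; rewrite e0; have [j j3 ->] := wlen0 e0.
  by exists [::], j; rewrite big_nil mul1g.
have [i ei] := wlen_descent e0.
have /is_wordP[u [j [su j3 eu]]] : is_word (enc (lmul i e)) (wlen (lmul i e)).
  by apply: IH; lia.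
apply/is_wordP; exists (i :: u), j; rewrite /= su ei big_cons -mulgA -eu.
by rewrite enc_lmul lmulK.
Qed.

(** [wlen] changes by one at each simple reflection and is preserved by [tau], so no word is
    shorter; removing descents one by one gives a word of exactly this size. *)
Lemma len_enc e : len (enc e) = wlen e.
Proof.
rewrite /len; case: ex_minnP => n /is_wordP[u [j [<- _ eu]]] min.
apply/eqP; rewrite eqn_leq min ?word_wlen //=.
by have := wlen_word u j; rewrite -eu encK.
Qed.

(** * Conjugacy classes *)

Definition cj i e := rmul (lmul i e) i.

(** On the left, [tau^-1] is the square of [wrot] on finite parts and (b, 1 - a - b), the inverse of
    (1 - a - b, a), on coordinates. *)
Definition cjtau (e : weyl * (int * int)) : weyl * (int * int) :=
  let: (u, (a, b)) := rtau e in (wrot (wrot u), (b, 1 - a - b)).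

Lemma enc_cj i e : enc (cj i e) = (sgen i * enc e * sgen i)%g.
Proof. by rewrite enc_lmul enc_rmul. Qed.

Lemma enc_cjtau e : enc (cjtau e) = (tau^-1 * enc e * tau)%g.
Proof.
rewrite -mulgA enc_rtau; apply: (mulgI tau); rewrite mulKVg enc_ltau; congr enc.
rewrite /cjtau; case: (rtau e) => u [a b] /=.
by congr (_, (_, _)); [case: u|lia].
Qed.

Lemma extaff_ind (P : extaff -> Prop) :
    P 1%g -> (forall i g, P g -> P (sgen i * g)%g) ->
  (forall g, P g -> P (tau * g)%g) -> forall g, P g.
Proof.
move=> P1 Ps Pt g; rewrite -[g]decK.
have /is_wordP[u [j [_ _ ->]]] := word_wlen (dec g).
elim: u => [|i u IH]; last by rewrite big_cons -mulgA; apply: Ps.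
by rewrite big_nil mul1g; elim: j => // j IH; rewrite expgS; apply: Pt.
Qed.

Lemma conj_classE g h : conj_class g h <-> exists x, h = (x^-1 * g * x)%g.
Proof. by split=> [[x _ <-]|[x ->]]; exists x. Qed.

Lemma conj_class_refl g : conj_class g g.
Proof. by apply/conj_classE; exists 1%g; rewrite invg1 mul1g mulg1. Qed.

Lemma conj_class_sym g h : conj_class g h -> conj_class h g.
Proof.
by move=> [x _ <-]; apply/conj_classE; exists x^-1%g; rewrite invgK !mulgA mulgV mul1g mulgK.
Qed.

Lemma conj_class_trans g h k : conj_class g h -> conj_class h k -> conj_class g k.
Proof.
move=> [x _ <-] [y _ <-]; apply/conj_classE; exists (x * y)%g.
by rewrite invMg !mulgA.
Qed.

Lemma conj_class_eq g h : conj_class g h -> conj_class g = conj_class h.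
Proof.
move=> gh; apply/seteqP; split=> k; last exact: conj_class_trans.
by apply: conj_class_trans; apply: conj_class_sym.
Qed.

Lemma conj_classJ g x : conj_class g (x * g * x^-1)%g.
Proof. by apply/conj_classE; exists x^-1%g; rewrite invgK. Qed.

Lemma conj_class_cj i e : conj_class (enc e) (enc (cj i e)).
Proof. by rewrite enc_cj -{2}sgenV; apply: conj_classJ. Qed.

(* The W-orbit of (a, b) is determined by the extreme values of its pairings
   with the orbit of 3 omega1. *)
Definition class_inv (e : weyl * (int * int)) : nat * (int * int) :=
  let: (u, (a, b)) := e in
  match u with
  | We => (0%N, (Num.max (2 * a + b) (Num.max (b - a) (- a - 2 * b)),
                 Num.min (2 * a + b) (Num.min (b - a) (- a - 2 * b))))
  | W1 => (1%N, (a + 2 * b, 0))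
  | W2 => (1%N, (- (2 * a + b), 0))
  | W121 => (1%N, (a - b, 0))
  | _ => (2, (((a - b) %% 3)%Z, 0))
  end.

Lemma inv_cj i e : class_inv (cj i e) = class_inv e.
Proof.
by case: e => u [a b]; case: i; case: u; rewrite /cj /=; congr (_, (_, _)); lia.
Qed.

Lemma inv_cjtau e : class_inv (cjtau e) = class_inv e.
Proof.
by case: e => u [a b]; case: u; rewrite /cjtau /=; congr (_, (_, _)); lia.
Qed.

Lemma inv_conj g h : conj_class g h -> class_inv (dec g) = class_inv (dec h).
Proof.
move=> [x _ <-]; elim/extaff_ind: x g => [|i x IH|x IH] g.
- by rewrite invg1 mul1g mulg1.
- have -> : ((sgen i * x)^-1 * g * (sgen i * x) = x^-1 * (sgen i * g * sgen i) * x)%g.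
    by rewrite invMg sgenV !mulgA.
  by rewrite -IH -[in RHS](decK g) -enc_cj encK inv_cj.
- have -> : ((tau * x)^-1 * g * (tau * x) = x^-1 * (tau^-1 * g * tau) * x)%g.
    by rewrite invMg !mulgA.
  by rewrite -IH -[in RHS](decK g) -enc_cjtau encK inv_cjtau.
Qed.

(** For dominant (a, b) the extremes are p = 2a + b and r = - a - 2b; the quotients solve for a and
    b. *)
Definition canon (k : nat * (int * int)) : weyl * (int * int) :=
  let: (n, (p, r)) := k in
  match n with
  | 0 => (We, (((2 * p + r) %/ 3)%Z, ((- p - 2 * r) %/ 3)%Z))
  | 1 => (W1, (p, 0))
  | _ => (W12, (p, 0))
  end.


Lemma conj_tr_W1 a b :
  (tr (b, 0) * enc (W1, (a, b)) = enc (W1, (a + 2 * b, 0)) * tr (b, 0))%g.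
Proof. by elt_compute. Qed.

Lemma conj_tr_W12 m n a b :
  (tr (m, n) * enc (W12, (a, b)) =
   enc (W12, (a + 2 * m + n, b + n - m)) * tr (m, n))%g.
Proof. by elt_compute. Qed.

Lemma conj_of_eq x g h : (x * g = h * x)%g -> conj_class g h.
Proof. by move=> e; rewrite -(mulgK x h) -e; apply: conj_classJ. Qed.

Lemma conj_canon e : conj_class (enc e) (enc (canon (class_inv e))).
Proof.
have W1P a b : conj_class (enc (W1, (a, b))) (enc (canon (class_inv (W1, (a, b))))).
  exact: conj_of_eq (conj_tr_W1 a b).
have W12P a b : conj_class (enc (W12, (a, b))) (enc (canon (class_inv (W12, (a, b))))).
  (* With m = n + b, these solve a + 2m + n = j and b + n - m = 0; the division is exact because a +
     2b and a - b agree modulo 3. *)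
  pose j := ((a - b) %% 3)%Z; pose n := ((j - a - 2 * b) %/ 3)%Z.
  apply: conj_of_eq (tr (n + b, n)) _ _ _; rewrite conj_tr_W12.
  by congr (enc (_, (_, _)) * _)%g; rewrite /= /n /j; lia.
have cjP i e' : conj_class (enc (cj i e')) (enc (canon (class_inv (cj i e')))) ->
    conj_class (enc e') (enc (canon (class_inv e'))).
  by rewrite inv_cj; apply: conj_class_trans; apply: conj_class_cj.
case: e => u [a b]; case: u => //.
- have dom a' b' : 0 <= a' -> 0 <= b' ->
      conj_class (enc (We, (a', b'))) (enc (canon (class_inv (We, (a', b'))))).
    move=> a0 b0; rewrite (_ : canon _ = (We, (a', b'))); first exact: conj_class_refl.
    by rewrite /=; congr (_, (_, _)); lia.
  have half a' b' : 0 <= a' + b' -> 0 <= b' ->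
      conj_class (enc (We, (a', b'))) (enc (canon (class_inv (We, (a', b'))))).
    move=> a0 b0; case: (lerP 0 a') => a1; first exact: dom.
    by apply: (cjP N1); apply: dom; lia.
  have anti a' b' : 0 <= a' + b' ->
      conj_class (enc (We, (a', b'))) (enc (canon (class_inv (We, (a', b'))))).
    move=> a0; case: (lerP 0 b') => b0; first exact: half.
    apply: (cjP N2); rewrite /cj /=; apply: dom; lia.
  case: (lerP 0 (a + b)) => ab; first exact: anti.
  case: (lerP 0 a) => a0; first by apply: (cjP N2); apply: (cjP N1); apply: anti; lia.
  by apply: (cjP N1); apply: (cjP N2); rewrite /cj /=; apply: anti; lia.
- by apply: (cjP N1); apply: (cjP N2); apply: W1P.
- by apply: (cjP N1); apply: W12P.
- by apply: (cjP N2); apply: W1P.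
Qed.

(** Translations are conjugate exactly along W-orbits. For t^x s with s a reflection, conjugation
    keeps the component of x along the mirror. For a rotation, conjugating by translations moves x
    by all of Q, since 1 - s1 s2 maps P onto Q, and only the class in P/Q survives. *)
Lemma conj_classP g h : conj_class g h <-> class_inv (dec g) = class_inv (dec h).
Proof.
split; first exact: inv_conj.
move=> e; have /conj_class_trans := conj_canon (dec g); rewrite e !decK; apply.
by apply: conj_class_sym; rewrite -{1}[h]decK; apply: conj_canon.
Qed.

Lemma conj_class_inv e : conj_class (enc e) = [set g | class_inv (dec g) = class_inv e].
Proof.
by apply/seteqP; split=> g /=; rewrite conj_classP encK => ->.
Qed.

Lemma coweight_comb (k l : int) :
  alpha1 *~ k + alpha2 *~ l = (2 * k - l, 2 * l - k).
Proof. by rewrite !mulrz_coweight; apply: coweight_ext => /=; lia. Qed.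

Lemma mk_tr x : tr x = enc (We, x). Proof. by case: x. Qed.

Lemma tr_s1 x : (tr x * s1)%g = enc (W1, x).
Proof. by case: x => a b; rewrite mk_tr -[s1]/(sgen N1) enc_rmul. Qed.

Lemma tr_s2 x : (tr x * s2)%g = enc (W2, x).
Proof. by case: x => a b; rewrite mk_tr -[s2]/(sgen N2) enc_rmul. Qed.

Lemma tr_s1s2 x : (tr x * s1 * s2)%g = enc (W12, x).
Proof. by case: x => a b; rewrite tr_s1 -[s2]/(sgen N2) enc_rmul. Qed.

Lemma tr_s2s1 x : (tr x * s2 * s1)%g = enc (W21, x).
Proof. by case: x => a b; rewrite tr_s2 -[s1]/(sgen N1) enc_rmul. Qed.

Lemma tr_s1s2s1 x : (tr x * s1 * s2 * s1)%g = enc (W121, x).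
Proof. by case: x => a b; rewrite tr_s1s2 -[s1]/(sgen N1) enc_rmul. Qed.

(** For t^x s1 the invariant is the pairing of x with 3 omega2, which kills alpha1 and is 3 on
    alpha2; the other two shapes are conjugates with the same value. So [C_ i] is a single class. *)
Lemma C_inv i : C_ i = [set g | class_inv (dec g) = (1%N, (3 * i%:Z, 0))].
Proof.
apply/seteqP; split=> [g [k]|g /=].
  rewrite !coweight_comb tr_s1 tr_s2 tr_s1s2s1.
  by case=> -> /=; rewrite encK /=; congr (_, (_, _)); lia.
rewrite -{2}[g]decK; case: (dec g) => u [a b]; case: u => //= -[e].
- exists (a + b - i%:Z); apply: Or31; rewrite coweight_comb tr_s1.
  by congr (enc (_, (_, _))); lia.
- exists (- 2 * i%:Z - a); apply: Or32; rewrite coweight_comb tr_s2.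
  by congr (enc (_, (_, _))); lia.
- exists (a - i%:Z); apply: Or33; rewrite coweight_comb tr_s1s2s1.
  by congr (enc (_, (_, _))); lia.
Qed.

Lemma C'_inv i : C'_ i = [set g | class_inv (dec g) = (1%N, (- (3 * i%:Z), 0))].
Proof.
apply/seteqP; split=> [g [k]|g /=].
  rewrite !coweight_comb tr_s1 tr_s2 tr_s1s2s1.
  by case=> -> /=; rewrite encK /=; congr (_, (_, _)); lia.
rewrite -{2}[g]decK; case: (dec g) => u [a b]; case: u => //= -[e].
- exists (a + b + i%:Z); apply: Or31; rewrite coweight_comb tr_s1.
  by congr (enc (_, (_, _))); lia.
- exists (2 * i%:Z - a); apply: Or32; rewrite coweight_comb tr_s2.
  by congr (enc (_, (_, _))); lia.
- exists (b - i%:Z); apply: Or33; rewrite coweight_comb tr_s1s2s1.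
  by congr (enc (_, (_, _))); lia.
Qed.

Lemma O_2_inv : O_2 = [set g | class_inv (dec g) = (2, (0, 0))].
Proof.
apply/seteqP; split=> [g [x [k [l ->]]]|g /=].
  rewrite coweight_comb tr_s1s2 tr_s2s1.
  by case=> -> /=; rewrite encK /=; congr (_, (_, _)); lia.
have rl a b : ((a - b) %% 3)%Z = 0 -> root_lattice (a, b).
  move=> e; exists ((2 * a + b) %/ 3)%Z, ((a + 2 * b) %/ 3)%Z.
  by rewrite coweight_comb; congr pair; lia.
rewrite -{2}[g]decK; case: (dec g) => u [a b]; case: u => //= -[e].
- by exists (a, b); [exact: rl|left; rewrite tr_s1s2].
- by exists (a, b); [exact: rl|right; rewrite tr_s2s1].
Qed.

(** * The Hecke algebra modulo commutators *)

Definition q : laurent := v - vinv.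

(* [lstep T i e] and [rstep T i e] are the products T_(s_i) T_e and T_e T_(s_i)
   in the standard basis, so [tracelike phi] says that phi extends to a trace. *)
Definition lstep (M : lmodType laurent) (F : weyl * (int * int) -> M) i e : M :=
  F (lmul i e) + (if (wlen (lmul i e) < wlen e)%N then q else 0) *: F e.

Definition rstep (M : lmodType laurent) (F : weyl * (int * int) -> M) i e : M :=
  F (rmul e i) + (if (wlen (rmul e i) < wlen e)%N then q else 0) *: F e.

Definition tracelike (phi : weyl * (int * int) -> laurent) : Prop :=
  (forall i e, lstep (phi : _ -> laurent^o) i e = rstep (phi : _ -> laurent^o) i e) /\
  (forall e, phi (ltau e) = phi (rtau e)).

(** An instance of the exchange condition: if s e and e s are both longer than e, then s e s is
    longer than e by 2 unless s e = e s. *)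
Lemma cj_fixed i e : wlen (lmul i e) = (wlen e).+1 -> wlen (rmul e i) = (wlen e).+1 ->
  wlen (cj i e) = wlen e -> cj i e = e.
Proof.
case: e => u [a b]; case: i; case: u; rewrite /cj /= => h h' h'';
  by [exfalso; lia | congr (_, (_, _)); lia].
Qed.

Lemma sum_by_value (M : zmodType) (I : Type) (J : eqType) (w : I -> J) (F : I -> M) (s : seq I) u :
    uniq u -> {subset map w s <= u} ->
  \sum_(x <- s) F x = \sum_(g <- u) \sum_(x <- s | w x == g) F x.
Proof.
move=> uu; rewrite (exchange_big_dep xpredT) //= => sub.
elim: s sub => [|x s IH] sub; rewrite ?big_nil ?big_cons //.
rewrite IH; last by move=> g gs; apply: sub; rewrite inE gs orbT.
congr (_ + _); rewrite -big_filter (_ : [seq g <- u | w x == g] = [:: w x]).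
  by rewrite big_seq1.
rewrite -(filter_pred1_uniq uu (sub (w x) _)) ?inE ?eqxx //.
by apply: eq_filter => g; rewrite /= eq_sym.
Qed.

Section HeckeAlgebra.

Variables (H : algType laurent) (T : extaff -> H).
Hypothesis hT : is_hecke_algebra T.

Let t e := T (enc e).

Lemma hecke_ind (P : H -> Prop) :
    (forall g, P (T g)) -> P 0 -> (forall a x y, P x -> P y -> P (a *: x + y)) ->
  forall h, P h.
Proof.
move=> PT P0 PD h; have [[span _] _ _] := hT; have [s [c ->]] := span h.
elim: s => [|g s IH]; first by rewrite big_nil.
by rewrite big_cons; apply: PD.
Qed.

Lemma hecke1 : T 1%g = 1.
Proof.
suff T1 h : T 1%g * h = h by rewrite -[LHS]mulr1 T1.
elim/hecke_ind: h => [g||a x y hx hy].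
- have len1 : len 1%g = 0%N by rewrite -enc1 len_enc.
  by have [_ mul _] := hT; rewrite mul mul1g // len1.
- by rewrite mulr0.
- by rewrite mulrDr -scalerAr hx hy.
Qed.

Lemma len_sgen i : len (sgen i) = 1%N.
Proof.
have -> : sgen i = enc (lmul i (We, (0, 0))) by rewrite -enc_lmul enc1 mulg1.
by rewrite len_enc; case: i.
Qed.

Lemma hecke_square i : T (sgen i) * T (sgen i) = q *: T (sgen i) + 1.
Proof.
have [_ _ quad] := hT; have [k ->] := sgen_simple i.
move: (quad k); rewrite mulrBl !mulrDr !mulr_algl !mulr_algr scalerA v_vinv scale1r.
move/eqP; rewrite subr_eq0 => /eqP e.
by rewrite scalerBl addrAC -e addrK.
Qed.

Lemma hecke_lmul i e : T (sgen i) * t e = lstep t i e.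
Proof.
have [_ mul _] := hT.
have up e' : wlen (lmul i e') = (wlen e').+1 -> T (sgen i) * t e' = t (lmul i e').
  by move=> h; rewrite mul enc_lmul // !len_enc len_sgen h.
rewrite /lstep; have [h|h] := wlen_lmul i e.
  by rewrite h ltnNge leqnSn /= scale0r addr0 up.
have := up (lmul i e); rewrite lmulK => /(_ h) eu.
by rewrite h ltnSn -eu mulrA hecke_square mulrDl -scalerAl mul1r addrC.
Qed.

Lemma hecke_rmul i e : t e * T (sgen i) = rstep t i e.
Proof.
have [_ mul _] := hT.
have up e' : wlen (rmul e' i) = (wlen e').+1 -> t e' * T (sgen i) = t (rmul e' i).
  by move=> h; rewrite mul enc_rmul // !len_enc len_sgen h addn1.
rewrite /rstep; have [h|h] := wlen_rmul i e.
  by rewrite h ltnNge leqnSn /= scale0r addr0 up.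
have := up (rmul e i); rewrite rmulK => /(_ h) eu.
by rewrite h ltnSn -eu -mulrA hecke_square mulrDr -scalerAr mulr1 addrC.
Qed.

Lemma len_tau : len tau = 0%N.
Proof.
have -> : tau = enc (ltau (We, (0, 0))) by rewrite -enc_ltau enc1 mulg1.
by rewrite len_enc.
Qed.

Lemma hecke_ltau e : T tau * t e = t (ltau e).
Proof.
by have [_ mul _] := hT; rewrite mul enc_ltau // !len_enc len_tau wlen_ltau.
Qed.

Lemma hecke_rtau e : t e * T tau = t (rtau e).
Proof.
by have [_ mul _] := hT; rewrite mul enc_rtau // !len_enc len_tau wlen_rtau addn0.
Qed.

Definition congr_comm (x y : H) : Prop := commutator_span (x - y).

Lemma commutator_span0 : commutator_span (0 : H).
Proof. by exists [::]; rewrite big_nil. Qed.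

Lemma commutator_spanD (x y : H) :
  commutator_span x -> commutator_span y -> commutator_span (x + y).
Proof. by move=> [s ->] [s' ->]; exists (s ++ s'); rewrite big_cat. Qed.

Lemma commutator_spanZ a (x : H) : commutator_span x -> commutator_span (a *: x).
Proof.
move=> [s ->]; exists [seq (a * p.1, p.2) | p <- s].
by rewrite big_map scaler_sumr; apply: eq_bigr => p _; rewrite scalerA.
Qed.

Lemma commutator_spanN (x : H) : commutator_span x -> commutator_span (- x).
Proof. by rewrite -scaleN1r; apply: commutator_spanZ. Qed.

Lemma congr_refl x : congr_comm x x.
Proof. by rewrite /congr_comm subrr; apply: commutator_span0. Qed.

Lemma congr_sym x y : congr_comm x y -> congr_comm y x.
Proof. by move/commutator_spanN; rewrite opprB. Qed.

Lemma congr_trans y x z : congr_comm x y -> congr_comm y z -> congr_comm x z.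
Proof.
move=> xy yz; rewrite /congr_comm -(subrK y x) -addrA.
exact: commutator_spanD.
Qed.

Lemma congrD x y x' y' :
  congr_comm x y -> congr_comm x' y' -> congr_comm (x + x') (y + y').
Proof. by rewrite /congr_comm opprD addrACA; apply: commutator_spanD. Qed.

Lemma congrZ a x y : congr_comm x y -> congr_comm (a *: x) (a *: y).
Proof. by rewrite /congr_comm -scalerBr; apply: commutator_spanZ. Qed.

Lemma congr_mulC x y : congr_comm (x * y) (y * x).
Proof. by exists [:: (1, (x, y))]; rewrite big_seq1 scale1r. Qed.

(** If e = s f with f shorter, then T_e = T_s T_f and T_(s e s) = T_f T_s. If s e is longer, either
    e commutes with s or e s is shorter, and then the same argument applies to s e s. *)
Lemma hecke_conj_eq i e : wlen (cj i e) = wlen e -> congr_comm (t e) (t (cj i e)).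
Proof.
have down e' : wlen (cj i e') = wlen e' -> wlen e' = (wlen (lmul i e')).+1 ->
    congr_comm (t e') (t (cj i e')).
  move=> h d; move: (hecke_lmul i (lmul i e')) (hecke_rmul i (lmul i e')).
  rewrite /lstep /rstep lmulK d -/(cj i e') h d !ltnNge leqnSn /= !scale0r !addr0.
  by move=> <- <-; apply: congr_mulC.
move=> h; have [u|d] := wlen_lmul i e; last exact: down.
have [->|fix_e] := pselect (cj i e = e); first exact: congr_refl.
have cjK : cj i (cj i e) = e.
  by apply: enc_inj; rewrite !enc_cj -!mulgA sgenK mulg1 !mulgA sgenK mul1g.
rewrite -{1}cjK; apply: congr_sym; apply: down; first by rewrite cjK.
have -> : lmul i (cj i e) = rmul e i.
  by apply: enc_inj; rewrite -enc_lmul enc_cj -enc_rmul !mulgA sgenK mul1g.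
by rewrite h; have [d|//] := wlen_rmul i e; case: fix_e; apply: cj_fixed.
Qed.

(** T_e = T_s T_(s e) is congruent to T_(s e) T_s = T_(s e s) T_s^2, and the quadratic relation
    expands the square. *)
Lemma hecke_conj_down i e : wlen e = (wlen (cj i e)).+2 ->
  congr_comm (t e) (t (cj i e) + q *: t (lmul i e)).
Proof.
move=> h.
have d : wlen e = (wlen (lmul i e)).+1 /\ wlen (lmul i e) = (wlen (cj i e)).+1.
  by rewrite /cj in h *; have [] := wlen_lmul i e; have [] := wlen_rmul i (lmul i e); lia.
move: (hecke_lmul i (lmul i e)) (hecke_rmul i (lmul i e)).
rewrite /lstep /rstep lmulK -/(cj i e) d.1 d.2 ltnNge leqnSn ltnSn /= scale0r addr0.
by move=> <- <-; apply: congr_mulC.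
Qed.

Lemma hecke_conj_tau e : congr_comm (t e) (t (cjtau e)).
Proof.
pose f := dec (tau^-1 * enc e)%g.
have fl : ltau f = e by apply: enc_inj; rewrite -enc_ltau decK mulKVg.
have fr : rtau f = cjtau e by apply: enc_inj; rewrite -enc_rtau decK enc_cjtau.
by rewrite -{1}fl -fr -hecke_ltau -hecke_rtau; apply: congr_mulC.
Qed.

Lemma hecke_relation (s : seq (laurent * extaff)) (phi : extaff -> laurent) :
  \sum_(x <- s) x.1 *: T x.2 = 0 -> \sum_(x <- s) x.1 * phi x.2 = 0.
Proof.
have [[_ free] _ _] := hT; set u := undup (map snd s).
have sub : {subset map snd s <= u} by move=> g; rewrite mem_undup.
rewrite (sum_by_value _ (undup_uniq _) sub) (sum_by_value (w := snd) _ (undup_uniq _) sub).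
pose c g := \sum_(x <- s | x.2 == g) x.1.
have cE (M : lmodType laurent) (F : extaff -> M) :
    \sum_(g <- u) \sum_(x <- s | x.2 == g) x.1 *: F x.2 = \sum_(g <- u) c g *: F g.
  by apply: eq_bigr => g _; rewrite scaler_suml; apply: eq_bigr => x /eqP ->.
rewrite cE => /(free _ _ (undup_uniq _)) c0.
rewrite (cE laurent^o) big1_seq // => g /andP[_ /c0 ->].
by rewrite scale0r.
Qed.

(** An expansion of each h in the basis is chosen; [hecke_relation] makes the resulting value
    independent of the choice and linear. *)
Lemma hecke_functional (phi : extaff -> laurent) : exists2 Phi : H -> laurent,
  forall g, Phi (T g) = phi g &
  forall a x y, Phi (a *: x + y) = a * Phi x + Phi y.
Proof.
have [[span _] _ _] := hT.
have sP h : exists s : seq (laurent * extaff), h == \sum_(x <- s) x.1 *: T x.2.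
  have [s [c ->]] := span h; exists [seq (c g, g) | g <- s].
  by rewrite big_map.
pose s h := xchoose (sP h).
have sE h : \sum_(x <- s h) x.1 *: T x.2 = h by rewrite -(eqP (xchooseP (sP h))).
exists (fun h => \sum_(x <- s h) x.1 * phi x.2) => [g|a x y].
  apply/eqP; rewrite -subr_eq0; apply/eqP.
  have := @hecke_relation ((-1, g) :: s (T g)) phi.
  by rewrite !big_cons /= sE scaleN1r addNr mulN1r addrC; apply.
have := @hecke_relation ([seq (a * p.1, p.2) | p <- s x] ++ s y ++
                         [seq (- p.1, p.2) | p <- s (a *: x + y)]) phi.
rewrite !big_cat !big_map /= sE.
under eq_bigr do rewrite -scalerA.
rewrite -scaler_sumr sE.
under [X in _ + (_ + X)]eq_bigr do rewrite scaleNr.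
rewrite sumrN sE addrA subrr => /(_ erefl).
under eq_bigr do rewrite -mulrA.
rewrite -mulr_sumr.
under [X in _ + (_ + X)]eq_bigr do rewrite mulNr.
by rewrite sumrN addrA => /eqP; rewrite subr_eq0 => /eqP ->.
Qed.

(** The symmetry Phi(x y) = Phi(y x) for y a generator is what [tracelike] says; it passes to y =
    T_g by induction on a word for g, and then to all y by linearity. *)
Lemma tracelike_commutator (phi : weyl * (int * int) -> laurent)
    (s : seq (laurent * extaff)) : tracelike phi ->
  commutator_span (\sum_(x <- s) x.1 *: T x.2) -> \sum_(x <- s) x.1 * phi (dec x.2) = 0.
Proof.
move=> [phis phit]; have [Phi PhiT PhiL] := hecke_functional (phi \o dec).
have PhiD x y : Phi (x + y) = Phi x + Phi y.
  by have := PhiL 1 x y; rewrite scale1r mul1r.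
have Phi0 : Phi 0 = 0.
  by apply: (addrI (Phi 0)); rewrite -PhiD !addr0.
have PhiZ a x : Phi (a *: x) = a * Phi x.
  by have := PhiL a x 0; rewrite Phi0 !addr0.
have PhiN x : Phi (- x) = - Phi x by rewrite -scaleN1r PhiZ mulN1r.
have Phit e : Phi (t e) = phi e by rewrite PhiT /= encK.
have PhiC y x : Phi (x * y) = Phi (y * x).
  elim/hecke_ind: y x => [g x|x|a y z hy hz x].
  - elim/extaff_ind: g x => [|i g IH|g IH] x.
    + by rewrite hecke1 mulr1 mul1r.
    + have sC z : Phi (z * T (sgen i)) = Phi (T (sgen i) * z).
        elim/hecke_ind: z => [k||a y z hy hz].
        * rewrite -[k]decK -/(t _) hecke_lmul hecke_rmul /lstep /rstep.
          by rewrite !PhiD !PhiZ !Phit; exact: esym (phis i (dec k)).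
        * by rewrite mulr0 mul0r.
        * by rewrite mulrDl mulrDr -scalerAl -scalerAr !PhiD !PhiZ hy hz.
      (* With c equal to q or 0 according to the length, the formula holds in both cases, so the
         induction may follow words that are not reduced. *)
      have [c ->] : exists c, T (sgen i * g)%g = T (sgen i) * T g - c *: T g.
        exists (if (wlen (lmul i (dec g)) < wlen (dec g))%N then q else 0).
        by rewrite -[g]decK -/(t _) hecke_lmul /lstep encK addrK enc_lmul.
      rewrite mulrBr mulrBl -scalerAl -scalerAr !PhiD !PhiN !PhiZ IH.
      by rewrite mulrA IH mulrA sC mulrA.
    + have tC z : Phi (z * T tau) = Phi (T tau * z).
        elim/hecke_ind: z => [k||a y z hy hz].
        * by rewrite -[k]decK -/(t _) hecke_ltau hecke_rtau !Phit phit.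
        * by rewrite mulr0 mul0r.
        * by rewrite mulrDl mulrDr -scalerAl -scalerAr !PhiD !PhiZ hy hz.
      rewrite -[in LHS](decK g) -[in RHS](decK g) enc_ltau -/(t _) -hecke_ltau.
      by rewrite mulrA /t decK IH mulrA tC mulrA.
  - by rewrite mulr0 mul0r.
  - by rewrite mulrDl mulrDr -scalerAl -scalerAr !PhiD !PhiZ hy hz.
move=> [r rE].
have -> : \sum_(x <- s) x.1 * phi (dec x.2) = Phi (\sum_(x <- s) x.1 *: T x.2).
  elim: s {rE} => [|x s IH]; first by rewrite !big_nil.
  by rewrite !big_cons PhiD PhiZ PhiT IH.
rewrite rE; elim: r {rE} => [|x r IH]; first by rewrite big_nil.
by rewrite big_cons PhiD PhiZ PhiD PhiN PhiC subrr mulr0 add0r.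
Qed.

End HeckeAlgebra.

(** * Trace functions *)

Definition rot (i : node) : node := match i with N0 => N1 | N1 => N2 | N2 => N0 end.

Lemma tau_sgen i : (tau * sgen i = sgen (rot i) * tau)%g.
Proof. by case: i; [exact: tau_s0|exact: tau_s1|exact: tau_s2]. Qed.

Lemma tau_expg j : (tau ^+ j)%g = enc (iter j ltau (We, (0, 0))).
Proof. by elim: j => // j IH; rewrite expgS IH enc_ltau. Qed.

Lemma lmul_braid i j e : i != j ->
  lmul i (lmul j (lmul i e)) = lmul j (lmul i (lmul j e)).
Proof.
by case: e => u [a b]; case: i; case: j => //= _;
  (congr (_, (_, _)); [case: u|lia..]).
Qed.

(** Two distinct descents force e to begin with the longest element s_i s_j s_i of the dihedral
    group of order 6, which can be removed letter by letter. *)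
Lemma wlen_braid i j e : i != j -> wlen e = (wlen (lmul i e)).+1 ->
  wlen e = (wlen (lmul j e)).+1 ->
  [/\ wlen (lmul i e) = (wlen (lmul j (lmul i e))).+1 &
      wlen (lmul j (lmul i e)) = (wlen (lmul i (lmul j (lmul i e)))).+1].
Proof.
by case: e => u [a b]; case: i; case: j => //= _; case: u => /= h h'; split; lia.
Qed.

Definition reduced_word e (w : seq node) (j : nat) :=
  [/\ size w = wlen e, (j < 3)%N & enc e = ((\prod_(i <- w) sgen i) * tau ^+ j)%g].

Lemma reduced_word_exists e : exists w j, reduced_word e w j.
Proof. by have /is_wordP[w [j h]] := word_wlen e; exists w, j. Qed.

Lemma reduced_word_cons i e w j : wlen (lmul i e) = (wlen e).+1 ->
  reduced_word e w j -> reduced_word (lmul i e) (i :: w) j.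
Proof.
by move=> l [sw j3 ew]; split; rewrite //= ?sw ?l // -enc_lmul ew big_cons mulgA.
Qed.

Lemma reduced_word_behead i e w j : reduced_word e (i :: w) j ->
  wlen e = (wlen (lmul i e)).+1 /\ reduced_word (lmul i e) w j.
Proof.
move=> [/= sw j3]; rewrite big_cons -mulgA => ew.
have el : enc (lmul i e) = ((\prod_(k <- w) sgen k) * tau ^+ j)%g.
  by rewrite -enc_lmul ew (mulgA (sgen i) (sgen i)) sgenK mul1g.
have := wlen_word w j; rewrite -el encK => lw.
have h : wlen e = (wlen (lmul i e)).+1 by have [] := wlen_lmul i e; lia.
by split=> //; split=> //; apply: succn_inj; rewrite sw h.
Qed.

Lemma tau_expg_inj j k : (j < 3)%N -> (k < 3)%N -> (tau ^+ j = tau ^+ k)%g -> j = k.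
Proof.
rewrite !tau_expg => j3 k3 /enc_inj.
by case: j j3 => [|[|[|//]]] _; case: k k3 => [|[|[|//]]].
Qed.

(** * Representations of the Hecke algebra on functions, and their traces *)

Section Operators.

Variables (Y : eqType) (act : node -> Y -> Y) (tact : Y -> Y) (c : node -> Y -> laurent).

Definition hop i (a : Y -> laurent) : Y -> laurent :=
  fun y => a (act i y) + c i y * a y.
Definition htau (a : Y -> laurent) : Y -> laurent := fun y => a (tact y).

Hypothesis hop_quadratic : forall i a, hop i (hop i a) = (fun y => q * hop i a y + a y).
Hypothesis hop_braid : forall i j a, i != j ->
  hop i (hop j (hop i a)) = hop j (hop i (hop j a)).
Hypothesis htau_hop : forall i a, htau (hop i a) = hop (rot i) (htau a).
Hypothesis htau3 : forall a, htau (htau (htau a)) = a.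

Definition wordop (w : seq node) (j : nat) (a : Y -> laurent) := foldr hop (iter j htau a) w.

(* Matsumoto's theorem: if e has descents i <> k, then it has reduced words
   starting with i k i and with k i k, which the braid relation identifies. *)
Lemma wordop_reduced e w j w' j' a : reduced_word e w j -> reduced_word e w' j' ->
  wordop w j a = wordop w' j' a.
Proof.
have [n] := ubnP (wlen e); elim: n e w j w' j' => // n IH e w j w' j' en r r'.
case: w w' r r' => [|i w] [|k w'] r r'; [|by case: r r' => [h _ _] [h' _ _]; rewrite -h in h' ..|].
  case: r r' => [_ j3 ej] [_ k3]; rewrite ej big_nil !mul1g.
  by move=> /(tau_expg_inj j3 k3) ->.
have [li ri] := reduced_word_behead r; have [lk rk] := reduced_word_behead r'.
have [ik|ik] := eqVneq i k.
  by rewrite /wordop /= -!/(wordop _ _ _) -ik (IH (lmul i e) w j w' j') //; [lia|rewrite ik].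
have [d1 d2] := wlen_braid ik li lk; have ki : k != i by rewrite eq_sym.
have [d3 d4] := wlen_braid ki lk li.
have [x [m rx]] := reduced_word_exists (lmul i (lmul k (lmul i e))).
have rix : reduced_word (lmul i e) (k :: i :: x) m.
  rewrite -[lmul i e](lmulK k) -[lmul k (lmul i e)](lmulK i).
  apply: reduced_word_cons; first by rewrite !lmulK.
  by apply: reduced_word_cons; rewrite ?lmulK.
have rkx : reduced_word (lmul k e) (i :: k :: x) m.
  move: rx; rewrite lmul_braid // => rx.
  rewrite -[lmul k e](lmulK i) -[lmul i (lmul k e)](lmulK k).
  apply: reduced_word_cons; first by rewrite !lmulK.
  by apply: reduced_word_cons; rewrite ?lmulK.
rewrite /wordop /= -!/(wordop _ _ _).
rewrite (IH _ _ _ _ _ _ ri rix); last lia.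
rewrite (IH _ _ _ _ _ _ rk rkx); last lia.
by rewrite /wordop /= hop_braid.
Qed.


Definition word_of e : seq node := projT1 (cid (reduced_word_exists e)).
Definition twist_of e : nat := projT1 (cid (projT2 (cid (reduced_word_exists e)))).

Lemma word_ofP e : reduced_word e (word_of e) (twist_of e).
Proof. by rewrite /word_of /twist_of; case: (cid (reduced_word_exists e)) => w h /=; case: cid. Qed.

Definition heckeop e : (Y -> laurent) -> Y -> laurent := wordop (word_of e) (twist_of e).

Lemma heckeopE e w j a : reduced_word e w j -> heckeop e a = wordop w j a.
Proof. exact: wordop_reduced (word_ofP e). Qed.

Lemma wordop_linear w j k a b :
  wordop w j (fun y => k * a y + b y) = (fun y => k * wordop w j a y + wordop w j b y).
Proof.
elim: w => [|i w IH]; rewrite /wordop /=.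
  by elim: j => //= j ->.
by rewrite -!/(wordop _ _ _) IH; apply: funext => y; rewrite /hop; ring.
Qed.

Lemma heckeop_lmul_up i e a : wlen (lmul i e) = (wlen e).+1 ->
  heckeop (lmul i e) a = hop i (heckeop e a).
Proof. by move=> l; rewrite (heckeopE _ (reduced_word_cons l (word_ofP e))). Qed.

Lemma iter_rot_sgen i j : (tau ^+ j * sgen i = sgen (iter j rot i) * tau ^+ j)%g.
Proof.
elim: j => [|j IH]; first by rewrite mulg1 mul1g.
by rewrite expgS -mulgA IH mulgA tau_sgen /= -mulgA.
Qed.

Lemma heckeop_rmul_up i e a : wlen (rmul e i) = (wlen e).+1 ->
  heckeop (rmul e i) a = heckeop e (hop i a).
Proof.
move=> l; have [sw j3 ew] := word_ofP e; set j := twist_of e in j3 ew *.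
have r : reduced_word (rmul e i) (rcons (word_of e) (iter j rot i)) j.
  split; rewrite ?size_rcons ?sw ?l // -enc_rmul ew big_rcons -!mulgA.
  by rewrite iter_rot_sgen.
rewrite (heckeopE _ r) /wordop foldr_rcons /heckeop /wordop; congr foldr.
by rewrite -/j; elim: {r} j {j3 ew} => //= j <-; rewrite htau_hop.
Qed.

Lemma iter_htau_mod j a : iter (j.+1 %% 3) htau a = iter j.+1 htau a.
Proof.
rewrite [in RHS](divn_eq j.+1 3) addnC iterD; congr iter.
by elim: (_ %/ _)%N => //= k IH; rewrite [RHS]/= htau3 -IH.
Qed.

Lemma tau_expg_mod j : (tau ^+ (j %% 3) = tau ^+ j)%g.
Proof.
have t3 : (tau ^+ 3 = 1)%g by have [] := tauP.
by rewrite {2}(divn_eq j 3) expgD mulnC expgM t3 expg1n mul1g.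
Qed.

Lemma heckeop_ltau e a : heckeop (ltau e) a = htau (heckeop e a).
Proof.
have [sw j3 ew] := word_ofP e; set j := twist_of e in j3 ew *.
(* Moving [tau] through the word rotates its letters; the exponent is taken modulo 3 because
   [reduced_word] requires it to be below 3. *)
have r : reduced_word (ltau e) (map rot (word_of e)) (j.+1 %% 3).
  split; rewrite ?size_map ?wlen_ltau ?ltn_pmod // tau_expg_mod -enc_ltau ew.
  rewrite big_map mulgA expgS mulgA; congr (_ * _)%g.
  elim: (word_of e) => [|k w IH]; first by rewrite !big_nil mulg1 mul1g.
  by rewrite !big_cons (mulgA tau) tau_sgen -(mulgA _ tau) IH mulgA.
rewrite (heckeopE _ r) /wordop iter_htau_mod /heckeop /wordop -/j /=.
elim: (word_of e) => //= k w ->; by rewrite htau_hop.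
Qed.

Lemma heckeop_rtau e a : heckeop (rtau e) a = heckeop e (htau a).
Proof.
have [sw j3 ew] := word_ofP e; set j := twist_of e in j3 ew *.
have r : reduced_word (rtau e) (word_of e) (j.+1 %% 3).
  split; rewrite ?wlen_rtau ?ltn_pmod // tau_expg_mod -enc_rtau ew.
  by rewrite expgSr (mulgA _ (tau ^+ _)%g).
by rewrite (heckeopE _ r) /wordop iter_htau_mod iterSr.
Qed.

Lemma hop_heckeop i e a : hop i (heckeop e a) = (fun y => heckeop (lmul i e) a y +
  (if (wlen (lmul i e) < wlen e)%N then q else 0) * heckeop e a y).
Proof.
apply: funext => y; have [l|l] := wlen_lmul i e.
  by rewrite -heckeop_lmul_up // l ltnNge leqnSn /= mul0r addr0.
have -> : heckeop e a = hop i (heckeop (lmul i e) a).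
  by rewrite -heckeop_lmul_up lmulK.
by rewrite hop_quadratic l ltnSn addrC.
Qed.

Lemma heckeop_hop i e a : heckeop e (hop i a) = (fun y => heckeop (rmul e i) a y +
  (if (wlen (rmul e i) < wlen e)%N then q else 0) * heckeop e a y).
Proof.
apply: funext => y; have [l|l] := wlen_rmul i e.
  by rewrite -heckeop_rmul_up // l ltnNge leqnSn /= mul0r addr0.
have E b : heckeop e b = heckeop (rmul e i) (hop i b).
  by rewrite -heckeop_rmul_up rmulK.
by rewrite [heckeop e a]E E hop_quadratic l ltnSn /heckeop wordop_linear addrC.
Qed.

Variables (K : Type) (shift : K -> Y -> Y) (D : seq Y).

Hypothesis actK : forall i, involutive (act i).
Hypothesis tact_inj : injective tact.
Hypothesis shift_inj : forall k, injective (shift k).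
Hypothesis shift_act : forall k i y, act i (shift k y) = shift k (act i y).
Hypothesis shift_tact : forall k y, tact (shift k y) = shift k (tact y).
Hypothesis shift_c : forall k i y, c i (shift k y) = c i y.
Hypothesis shiftC : forall k l y, shift k (shift l y) = shift l (shift k y).
(* [D] is a fundamental domain for the shifts. *)
Hypothesis domain_act : forall (F : Y -> laurent) i, (forall k y, F (shift k y) = F y) ->
  \sum_(y <- D) F (act i y) = \sum_(y <- D) F y.
Hypothesis domain_tact : forall F : Y -> laurent, (forall k y, F (shift k y) = F y) ->
  \sum_(y <- D) F (tact y) = \sum_(y <- D) F y.

Definition delta (z : Y) : Y -> laurent := fun y => (y == z)%:R.

(* The coefficient of the monomial [k] in the trace of e, when functions on [Y]
   are viewed as a free module of finite rank over the group ring of the shifts. *)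
Definition shift_trace k e : laurent := \sum_(y <- D) heckeop e (delta (shift k y)) y.

Lemma heckeop_shift e a k y : heckeop e (fun z => a (shift k z)) y = heckeop e a (shift k y).
Proof.
suff E w j : wordop w j (fun z => a (shift k z)) = (fun z => wordop w j a (shift k z)).
  by rewrite /heckeop E.
elim: w => [|i w IH]; rewrite /wordop /=; last first.
  rewrite -!/(wordop _ _ _) IH; apply: funext => z.
  by rewrite /hop shift_act shift_c.
by elim: j => //= j ->; apply: funext => z; rewrite /htau shift_tact.
Qed.

Lemma delta_shift k z : (fun y => delta (shift k z) (shift k y)) = delta z.
Proof. by apply: funext => y; rewrite /delta (inj_eq (@shift_inj k)). Qed.

Lemma hop_delta i z : hop i (delta z) = (fun y => c i z * delta z y + delta (act i z) y).
Proof.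
apply: funext => y; rewrite /hop /delta addrC; congr (_ + _).
  by case: eqP => [->|]; rewrite ?mulr0.
by rewrite (can2_eq (actK i) (actK i)).
Qed.

(** Composing with T_i on either side gives the same diagonal terms, weighted by [c]. The
    off-diagonal terms differ by the substitution of [act i y] for y, which is harmless because the
    summand is invariant under shifts and [D] is a fundamental domain. *)
Lemma shift_trace_tracelike k : tracelike (shift_trace k).
Proof.
split=> [i e|e].
- have hl : lstep (shift_trace k : _ -> laurent^o) i e =
      \sum_(y <- D) hop i (heckeop e (delta (shift k y))) y.
    rewrite /lstep /shift_trace /GRing.scale /= mulr_sumr -big_split /=.
    by apply: eq_bigr => y _; rewrite hop_heckeop.
  have hr : rstep (shift_trace k : _ -> laurent^o) i e =
      \sum_(y <- D) heckeop e (hop i (delta (shift k y))) y.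
    rewrite /rstep /shift_trace /GRing.scale /= mulr_sumr -big_split /=.
    by apply: eq_bigr => y _; rewrite heckeop_hop.
  rewrite hl hr; under [RHS]eq_bigr do
    rewrite hop_delta {1}/heckeop wordop_linear -/(heckeop _ _ _) shift_c shift_act.
  rewrite /hop big_split [RHS]big_split /= addrC; congr (_ + _).
  rewrite -(@domain_act (fun y => heckeop e (delta (shift k (act i y))) y) i) => [|l y].
    by apply: eq_bigr => y _; rewrite actK.
  by rewrite -heckeop_shift shift_act shiftC delta_shift.
- rewrite /shift_trace; under eq_bigr do rewrite heckeop_ltau /htau.
  under [RHS]eq_bigr do rewrite heckeop_rtau.
  rewrite -(@domain_tact (fun y => heckeop e (htau (delta (shift k y))) y)) => [|l y].
    apply: eq_bigr => y _; congr (heckeop e _ _); apply: funext => z.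
    by rewrite /htau /delta -shift_tact (inj_eq tact_inj).
  rewrite -heckeop_shift; congr heckeop; apply: funext => z.
  by rewrite /htau shift_tact shiftC -[in RHS](delta_shift l).
Qed.

End Operators.

Local Notation "p %:F" := (@FracField.tofrac _ p).

(** * Specialization at v = 1 and independence of the classes *)

Lemma laurent_val_inj : injective laurent_val.
Proof. exact: val_inj. Qed.

Lemma laurent_valB x y : laurent_val (x - y) = laurent_val x - laurent_val y.
Proof. exact: (rmorphB val). Qed.

Lemma laurent_valM x y : laurent_val (x * y) = laurent_val x * laurent_val y.
Proof. exact: (rmorphM val). Qed.

Lemma laurent_val0 : laurent_val 0 = 0. Proof. exact: (rmorph0 val). Qed.

Lemma laurent_val1 : laurent_val 1 = 1. Proof. exact: (rmorph1 val). Qed.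

Lemma laurent_valXn x n : laurent_val (x ^+ n) = laurent_val x ^+ n.
Proof. exact: (rmorphXn val). Qed.

Lemma laurentP (x : laurent) :
  exists pn : {poly int} * nat, laurent_val x * 'X%:F ^+ pn.2 = pn.1%:F.
Proof. by have /asboolP[p [n e]] := laurent_valP x; exists (p, n). Qed.

(** Evaluation at v = 1, read off from a chosen fraction p / v^n; [ev1E] shows that the choice does
    not matter. *)
Definition ev1 (x : laurent) : int := (projT1 (cid (laurentP x))).1.[1].

Lemma ev1E x p n : laurent_val x * 'X%:F ^+ n = p%:F -> ev1 x = p.[1].
Proof.
rewrite /ev1; case: cid => -[r m] /= er ep.
have : r * 'X^n = p * 'X^m.
  apply/eqP; rewrite -tofrac_eq !tofracM !tofracXn -er -ep; apply/eqP.
  by rewrite -!mulrA [X in _ * X = _]mulrC.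
move/(congr1 (fun z : {poly int} => z.[1])).
by rewrite !hornerM !hornerXn !expr1n !mulr1.
Qed.

Lemma ev1_zmod : zmod_morphism ev1.
Proof.
move=> x y; have [[p m] /= ep] := laurentP x; have [[r n] /= er] := laurentP y.
rewrite (ev1E ep) (ev1E er) (@ev1E _ (p * 'X^n - r * 'X^m) (m + n)).
  by rewrite hornerD hornerN !hornerM !hornerXn !expr1n !mulr1.
rewrite tofracB !tofracM !tofracXn -ep -er laurent_valB mulrBl exprD.
by congr (_ - _); rewrite ?mulrA // -!mulrA [X in _ * X]mulrC.
Qed.

Lemma ev1_monoid : monoid_morphism ev1.
Proof.
split; first by rewrite (@ev1E 1 1 0) ?hornerC // laurent_val1 tofrac1 mulr1.
move=> x y; have [[p m] /= ep] := laurentP x; have [[r n] /= er] := laurentP y.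
rewrite (ev1E ep) (ev1E er) (@ev1E _ (p * r) (m + n)) ?hornerM //.
by rewrite tofracM -ep -er laurent_valM exprD mulrACA.
Qed.

HB.instance Definition _ := GRing.isZmodMorphism.Build laurent int ev1 ev1_zmod.
HB.instance Definition _ := GRing.isMonoidMorphism.Build laurent int ev1 ev1_monoid.

Lemma ev1_v : ev1 v = 1.
Proof. by rewrite (@ev1E v 'X 0) ?hornerX //= mulr1. Qed.

Lemma ev1_vinv : ev1 vinv = 1.
Proof.
by rewrite (@ev1E vinv 1 1) ?hornerC //= expr1 mulVf ?tofracX_neq0 // tofrac1.
Qed.

Lemma ev1_q : ev1 q = 0.
Proof. by rewrite rmorphB /= ev1_v ev1_vinv subrr. Qed.

Lemma ev1_eq0 x : ev1 x = 0 -> exists y, x = (v - 1) * y.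
Proof.
have [[p n] /= ep] := laurentP x; rewrite (ev1E ep) => /rootP/factor_theorem[r er].
have Xn0 : ('X : {poly int})%:F ^+ n != 0 by rewrite expf_neq0 ?tofracX_neq0.
have yP : is_laurent (r%:F / 'X%:F ^+ n) by apply/asboolP; exists r, n; rewrite divfK.
exists (Laurent yP); apply: laurent_val_inj; rewrite laurent_valM laurent_valB laurent_val1 /=.
apply: (mulIf Xn0); rewrite ep er tofracM tofracB tofrac1 -mulrA divfK //.
exact: mulrC.
Qed.

Lemma subv1_neq0 : laurent_val (v - 1) != 0.
Proof.
rewrite laurent_valB laurent_val1 /= -tofrac1 -tofracB tofrac_eq0; apply/negP => /eqP.
by move/(congr1 (fun p : {poly int} => p.[0])); rewrite !hornerE.
Qed.

Lemma subv1_inj x y : (v - 1) * x = (v - 1) * y -> x = y.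
Proof.
move/(congr1 laurent_val); rewrite !laurent_valM => /(mulfI subv1_neq0).
exact: laurent_val_inj.
Qed.

Lemma subv1_exp_inj k x y : (v - 1) ^+ k * x = (v - 1) ^+ k * y -> x = y.
Proof.
by elim: k => [|k IH]; rewrite ?mul1r // exprS -!mulrA => /subv1_inj.
Qed.

(** A nonzero polynomial has finite multiplicity at 1. This ends the repeated division: a
    coefficient divisible by every power of v - 1 vanishes. *)
Lemma subv1_order x : x != 0 -> exists k y, x = (v - 1) ^+ k * y /\ ev1 y != 0.
Proof.
move=> x0; have [[p n] /= ep] := laurentP x.
have Xn0 : ('X : {poly int})%:F ^+ n != 0 by rewrite expf_neq0 ?tofracX_neq0.
have p0 : p != 0.
  apply: contraNneq x0 => p0; apply/eqP/laurent_val_inj; apply: (mulIf Xn0).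
  by rewrite ep p0 tofrac0 laurent_val0 mul0r.
have [k [r]] := multiplicity_XsubC p 1; rewrite p0 /= => r1 er.
have yP : is_laurent (r%:F / 'X%:F ^+ n) by apply/asboolP; exists r, n; rewrite divfK.
exists k, (Laurent yP); split; last by rewrite (@ev1E _ r n) ?divfK.
apply: laurent_val_inj; rewrite laurent_valM laurent_valXn laurent_valB laurent_val1 /=.
apply: (mulIf Xn0); rewrite ep er tofracM tofracXn tofracB tofrac1 -mulrA divfK //.
exact: mulrC.
Qed.

(** Expand both cubic words at y. The three conditions on [c] compare the coefficients at
    [act j (act i y)], at [act i y] and at y; the terms at [act i (act j (act i y))] match by the
    braid relation for [act]. *)
Lemma hop_braid_of (Y : eqType) (act : node -> Y -> Y) (c : node -> Y -> laurent) :
    (forall i, involutive (act i)) ->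
    (forall i j y, i != j ->
      act i (act j (act i y)) = act j (act i (act j y))) ->
    (forall i j y, i != j -> c i (act j (act i y)) = c j y) ->
    (forall i j y, i != j ->
      c j (act i y) * c i (act i y) + c i y * c j y = c j y * c j (act i y)) ->
    (forall i j y, i != j ->
      c j (act i y) + c i y ^+ 2 * c j y = c i (act j y) + c j y ^+ 2 * c i y) ->
  forall i j a, i != j ->
    hop act c i (hop act c j (hop act c i a)) = hop act c j (hop act c i (hop act c j a)).
Proof.
move=> actK actB c1 c2 c3 i j a ij; have ji : j != i by rewrite eq_sym.
apply: funext => y; rewrite /hop !actK actB //.
have := c1 i j y ij; have := c1 j i y ji; have := c2 i j y ij; have := c2 j i y ji.
have := c3 i j y ij.
set cij := c i (act j (act i y)); set cji := c j (act i (act j y)).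
move=> /eqP; rewrite -subr_eq0 => /eqP h3 /eqP; rewrite -subr_eq0 => /eqP h2'.
move=> /eqP; rewrite -subr_eq0 => /eqP h2 -> ->.
apply: subr0_eq; rewrite -[RHS](_ : 0 * a (act i y) - 0 * a (act j y) + 0 * a y = 0).
  by rewrite -{1}h2 -{1}h2' -{1}h3; ring.
by rewrite !mul0r subrr addr0.
Qed.

(* Principal series: [alcove_up u i] says that the neighbour of the alcove t^x u
   across its wall of type i lies on the positive side of that wall.  This does
   not depend on x, so the operators commute with translations. *)
Definition alcove_up (u : weyl) (i : node) : bool :=
  match i with
  | N0 => u \in [:: We; W1; W2]
  | N1 => u \in [:: W1; W21; W121]
  | N2 => u \in [:: W2; W12; W121]
  end.

Definition alcove_coef (i : node) (e : weyl * (int * int)) : laurent :=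
  if alcove_up e.1 i then q else 0.

Definition translate (k : int * int) (e : weyl * (int * int)) : weyl * (int * int) :=
  let: (u, (a, b)) := e in (u, (k.1 + a, k.2 + b)).

Definition alcove_domain : seq (weyl * (int * int)) :=
  [seq (u, (0, 0)) | u <- [:: We; W1; W2; W12; W21; W121]].

Definition alcove_trace :=
  shift_trace (fun i e => rmul e i) rtau alcove_coef translate alcove_domain.

Lemma rmul_braid i j e : i != j ->
  rmul (rmul (rmul e i) j) i = rmul (rmul (rmul e j) i) j.
Proof.
by case: e => u [a b]; case: i; case: j => //= _; case: u => /=; congr (_, (_, _)); lia.
Qed.

Lemma rtau_rmul i e : rmul (rtau e) i = rtau (rmul e (rot i)).
Proof.
by case: e => u [a b]; case: i; case: u => /=; congr (_, (_, _)); lia.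
Qed.

Lemma rtau3 e : rtau (rtau (rtau e)) = e.
Proof. by case: e => u [a b]; case: u => /=; congr (_, (_, _)); lia. Qed.

Lemma alcove_trace_tracelike k : tracelike (alcove_trace k).
Proof.
have domain (F : weyl * (int * int) -> laurent) u a b :
    (forall k y, F (translate k y) = F y) -> F (u, (a, b)) = F (u, (0, 0)).
  by move=> Fk; rewrite -(Fk (a, b) (u, (0, 0))) /= !addr0.
apply: shift_trace_tracelike.
- move=> i a; apply: funext => e; rewrite /hop rmulK /alcove_coef.
  by case: e => u [x y]; case: i; case: u => /=; ring.
- apply: hop_braid_of.
  + exact: rmulK.
  + by move=> i j y ij; rewrite rmul_braid.
  + by move=> i j [u [a b]]; case: i; case: j => // _; case: u.
  + by move=> i j [u [a b]]; case: i; case: j => // _; case: u; rewrite /alcove_coef /=; ring.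
  + by move=> i j [u [a b]]; case: i; case: j => // _; case: u; rewrite /alcove_coef /=; ring.
- move=> i a; apply: funext => e; rewrite /htau /hop rtau_rmul; congr (_ + _ * _).
  by case: e => u [x y]; case: i; case: u.
- by move=> a; apply: funext => e; rewrite /htau rtau3.
- exact: rmulK.
- by apply: (@can_inj _ _ _ (rtau \o rtau)) => e; rewrite /= rtau3.
- by move=> {k} k [u [a b]] [w [x y]] [-> /addrI -> /addrI ->].
- move=> {k} k i [u [a b]]; case: i; case: u => /=; congr (_, (_, _)); lia.
- move=> {k} k [u [a b]]; case: u => /=; congr (_, (_, _)); lia.
- by move=> {k} k i [u [a b]].
- by move=> {k} k l [u [a b]] /=; congr (_, (_, _)); lia.
- move=> F i Fk; rewrite /alcove_domain !big_map !big_cons !big_nil.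
  by case: i => /=; rewrite !(domain F _ _ _ Fk); ring.
- move=> F Fk; rewrite /alcove_domain !big_map !big_cons !big_nil.
  by rewrite /= !(domain F _ _ _ Fk); ring.
Qed.

(* The representation induced from a Levi subgroup of type A_1: the basis is
   indexed by the coordinates of Z^3 together with a translation part. *)
Definition line_act (i : node) (y : node * int) : node * int :=
  match i, y with
  | N0, (N0, n) => (N2, n + 3) | N0, (N2, n) => (N0, n - 3)
  | N1, (N0, n) => (N1, n) | N1, (N1, n) => (N0, n)
  | N2, (N1, n) => (N2, n) | N2, (N2, n) => (N1, n)
  | _, _ => y
  end.

(** Coordinates are scaled by 3 to be integral: the shifts 2, -1, -1 are those of omega1, as the 3
    and -3 in [line_act] are those of alpha1 + alpha2. *)
Definition line_tau (y : node * int) : node * int :=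
  match y with
  | (N0, n) => (N2, n + 2) | (N1, n) => (N0, n - 1) | (N2, n) => (N1, n - 1)
  end.

(* The fixed points of s_i carry v - 1, so that [hop] acts there by v. *)
Definition line_coef (i : node) (y : node * int) : laurent :=
  if line_act i y == y then v - 1 else if i == y.1 then q else 0.

Definition line_shift (k : int) (y : node * int) : node * int := (y.1, k + y.2).

Definition line_domain : seq (node * int) := [seq (i, 0) | i <- [:: N0; N1; N2]].

Definition line_trace := shift_trace line_act line_tau line_coef line_shift line_domain.

Lemma line_coefE i j n : line_coef i (j, n) =
  match i, j with
  | N0, N1 | N1, N2 | N2, N0 => v - 1
  | N0, N0 | N1, N1 | N2, N2 => q
  | _, _ => 0
  end.
Proof. by case: i; case: j; rewrite /line_coef /= ?eqxx //; case: eqP => // -[]. Qed.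

Lemma line_trace_tracelike k : tracelike (line_trace k).
Proof.
have domain (F : node * int -> laurent) i n :
    (forall k y, F (line_shift k y) = F y) -> F (i, n) = F (i, 0).
  by move=> Fk; rewrite -(Fk n (i, 0)) /line_shift /= addr0.
have qE : q = v - vinv by [].
apply: shift_trace_tracelike.
- move=> i a; apply: funext => -[j n]; case: i; case: j;
    rewrite /hop /= !line_coefE ?addrK ?subrK /q; ring: v_vinv.
- move=> i j a; case: i; case: j => // _; apply: funext => -[k' n]; case: k';
    rewrite /hop /= !line_coefE ?addrK ?subrK /q; ring: v_vinv.
- move=> i a; apply: funext => -[j n]; rewrite /htau /hop /=; case: i; case: j;
    rewrite /= !line_coefE; congr (a (_, _) + _); lia.
- move=> a; apply: funext => -[j n]; rewrite /htau; case: j => /=;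
    congr (a (_, _)); lia.
- by move=> i [j n]; case: i; case: j => //=; rewrite ?addrK ?subrK.
- by move=> [i m] [j n]; case: i; case: j => //= -[]; do ?move/addIr->.
- by move=> {k} k [i m] [j n] [-> /addrI ->].
- by move=> {k} k i [j n]; case: i; case: j; rewrite /line_shift /= ?addrA.
- by move=> {k} k [j n]; case: j; rewrite /line_shift /= ?addrA.
- by move=> {k} k i [j n]; rewrite /line_shift !line_coefE.
- by move=> {k} k l [j n]; rewrite /line_shift /= addrCA.
- move=> F i Fk; rewrite /line_domain !big_map !big_cons !big_nil.
  by case: i => /=; rewrite !(domain F _ _ Fk); ring.
- move=> F Fk; rewrite /line_domain !big_map !big_cons !big_nil.
  by rewrite /= !(domain F _ _ Fk); ring.
Qed.

(** The character sending T_s to v, cut down to one coset of the affine Weyl group; these cosets are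
    labelled by a - b modulo 3. *)
Definition component_trace (j : int) (e : weyl * (int * int)) : laurent :=
  if ((e.2.1 - e.2.2) %% 3)%Z == j then v ^+ wlen e else 0.

Lemma component_lmul i e : (((lmul i e).2.1 - (lmul i e).2.2) %% 3)%Z = ((e.2.1 - e.2.2) %% 3)%Z.
Proof. by case: e => u [a b]; case: i => /=; lia. Qed.

Lemma component_rmul i e : (((rmul e i).2.1 - (rmul e i).2.2) %% 3)%Z = ((e.2.1 - e.2.2) %% 3)%Z.
Proof. by case: e => u [a b]; case: i; case: u => /=; lia. Qed.

Lemma component_trace_tracelike j : tracelike (component_trace j).
Proof.
have vq l : v ^+ l + q * v ^+ l.+1 = v * v ^+ l.+1.
  rewrite /q !exprS; ring: v_vinv.
split=> [i e|e].
- have hl : lstep (component_trace j : _ -> laurent^o) i e = v * component_trace j e.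
    rewrite /lstep /GRing.scale /= /component_trace component_lmul.
    case: eqP => _; rewrite ?mulr0 ?addr0 //.
    have [l|l] := wlen_lmul i e; first by rewrite l ltnNge leqnSn /= mul0r addr0 exprS.
    by rewrite l ltnSn vq.
  rewrite hl; rewrite /rstep /GRing.scale /= /component_trace component_rmul.
  case: eqP => _; rewrite ?mulr0 ?addr0 //.
  have [l|l] := wlen_rmul i e; first by rewrite l ltnNge leqnSn /= mul0r addr0 exprS.
  by rewrite l ltnSn vq.
- rewrite /component_trace wlen_ltau wlen_rtau; congr (if _ == _ then _ else _).
  by case: e => u [a b]; case: u => /=; lia.
Qed.

(** At v = 1 the coefficients [c] vanish and the operators only permute points; [ya] names the
    resulting right action of the group on [Y]. *)
Lemma ev1_heckeop (Y : eqType) (act : node -> Y -> Y) tact c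
    (ya : weyl * (int * int) -> Y -> Y) e a y :
    (forall i z, ev1 (c i z) = 0) -> (forall z, ya (We, (0, 0)) z = z) ->
    (forall i e' z, ya (lmul i e') z = ya e' (act i z)) ->
    (forall e' z, ya (ltau e') z = ya e' (tact z)) ->
  ev1 (heckeop act tact c e a y) = ev1 (a (ya e y)).
Proof.
move=> c0 ya1 yal yat; have [_ _ ew] := word_ofP e.
rewrite /heckeop; move: (twist_of e) (word_of e) ew => j w ew.
have {ew} -> : e = foldr lmul (iter j ltau (We, (0, 0))) w.
  apply: enc_inj; rewrite ew tau_expg; elim: w {ew} => [|i w IH].
    by rewrite big_nil mul1g.
  by rewrite big_cons -mulgA IH enc_lmul.
elim: w y => [|i w IH] y /=.
  by elim: j y => [|j IH] y /=; rewrite ?ya1 // yat -IH.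
by rewrite /wordop /= -!/(wordop _ _ _) /hop rmorphD rmorphM /= c0 mul0r addr0 IH yal.
Qed.

(** The condition says y e = t^k y, so the sum counts the elements of W conjugating e to t^k; it
    vanishes off the class of t^k. *)
Lemma ev1_alcove_trace k e : ev1 (alcove_trace k e) =
  \sum_(y <- alcove_domain) (dec (enc y * enc e)%g == translate k y)%:R.
Proof.
rewrite rmorph_sum; apply: eq_bigr => y _.
pose ya e (y : weyl * (int * int)) := dec (enc y * enc e)%g.
apply: etrans (@ev1_heckeop _ _ _ _ ya _ _ _ _ _ _ _) _; rewrite ?/ya.
- by move=> i [u p]; rewrite /alcove_coef; case: ifP => _; rewrite ?ev1_q ?rmorph0.
- by move=> z; rewrite enc1 mulg1 encK.
- by move=> i e' z; rewrite -enc_lmul mulgA enc_rmul.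
- by move=> e' z; rewrite -enc_ltau mulgA enc_rtau.
- by rewrite /delta rmorph_nat.
Qed.

Definition line_perm (u : weyl) (i : node) : node :=
  match u, i with
  | We, _ => i
  | W1, N0 => N1 | W1, N1 => N0 | W1, N2 => N2
  | W2, N0 => N0 | W2, N1 => N2 | W2, N2 => N1
  | W12, N0 => N2 | W12, N1 => N0 | W12, N2 => N1
  | W21, N0 => N1 | W21, N1 => N2 | W21, N2 => N0
  | W121, N0 => N2 | W121, N1 => N1 | W121, N2 => N0
  end.

Definition line_coord (i : node) (a b : int) : int :=
  match i with N0 => 2 * a + b | N1 => b - a | N2 => - a - 2 * b end.

(** The finite part must fix the coordinate i: this allows three coordinates for a translation, one
    for a reflection and none for a rotation. *)
Lemma ev1_line_trace k e : ev1 (line_trace k e) =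
  \sum_(i <- [:: N0; N1; N2])
    ((line_perm e.1 i == i) && (line_coord i e.2.1 e.2.2 == k))%:R.
Proof.
rewrite rmorph_sum /line_domain big_map; apply: eq_bigr => i _.
pose ya (e : weyl * (int * int)) (y : node * int) :=
  (line_perm e.1 y.1, y.2 + line_coord y.1 e.2.1 e.2.2).
apply: etrans (@ev1_heckeop _ _ _ _ ya _ _ _ _ _ _ _) _.
- move=> j [l n]; rewrite line_coefE.
  have ev1_subv1 : ev1 (v - 1) = 0 by rewrite rmorphB rmorph1 /= ev1_v subrr.
  by case: j; case: l; rewrite ?ev1_q ?ev1_subv1 ?rmorph0.
- by move=> [l n]; rewrite /ya /=; congr (_, _); case: l => /=; lia.
- move=> j [u [a b]] [l n]; rewrite /ya.
  by case: j; case: l; case: u => /=; congr (_, _); lia.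
- move=> [u [a b]] [l n]; rewrite /ya.
  by case: l; case: u => /=; congr (_, _); lia.
- by rewrite /delta rmorph_nat /ya /line_shift /= xpair_eqE add0r addr0.
Qed.

Lemma int_sum_eq0 (I : eqType) (s : seq I) (x y : I -> int) i : uniq s -> i \in s ->
    \sum_(j <- s) x j * y j = 0 -> y i != 0 ->
    (forall j, j \in s -> j != i -> x j = 0 \/ y j = 0) ->
  x i = 0.
Proof.
move=> us si + yi z; rewrite (bigD1_seq i) //= big1_seq ?addr0.
  by move/eqP; rewrite mulf_eq0 (negPf yi) orbF => /eqP.
by move=> j /andP[ji sj]; have [->|->] := z j sj ji; rewrite ?mul0r ?mulr0.
Qed.

Section Independence.

Variables (I : eqType) (s : seq I) (w : I -> weyl * (int * int)).
Hypothesis s_uniq : uniq s.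
Hypothesis w_inj : {in s &, forall i j, class_inv (w i) = class_inv (w j) -> i = j}.

(** The three families are triangular. The principal series isolates each translation class; once
    these coefficients are gone, the line traces isolate reflection classes, as they vanish on
    rotations; the component traces then separate the rotations. *)
Lemma trace_independence_ev1 (c : I -> laurent) :
    (forall phi, tracelike phi -> \sum_(i <- s) c i * phi (w i) = 0) ->
  {in s, forall i, ev1 (c i) = 0}.
Proof.
move=> rel.
have rel1 phi : tracelike phi -> \sum_(i <- s) ev1 (c i) * ev1 (phi (w i)) = 0.
  move=> /rel /(congr1 ev1); rewrite rmorph0 rmorph_sum => h; rewrite -[RHS]h.
  by apply: eq_bigr => i _; rewrite rmorphM.
have c0 : {in s, forall i, (class_inv (w i)).1 = 0%N -> ev1 (c i) = 0}.
  move=> i si; case wi: (w i) => [u [a b]]; case: u wi => // wi _.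
  apply: (int_sum_eq0 s_uniq si (rel1 _ (alcove_trace_tracelike (a, b)))).
    rewrite ev1_alcove_trace big_cons wi enc1 mul1g encK.
    by rewrite /= !addr0 eqxx lt0r_neq0 // ltr_wpDr // sumr_ge0.
  move=> j sj ji; right; rewrite ev1_alcove_trace big1_seq // => y _.
  case: eqP => // /(congr1 enc); rewrite decK => yw; case/eqP: ji.
  apply: w_inj => //; rewrite wi -(encK (w j)) -(encK (We, (a, b))).
  apply/conj_classP/(conj_of_eq (x := enc y)); rewrite yw.
  by case: y {yw} => u [m n]; elt_compute.
have c1 : {in s, forall i, (class_inv (w i)).1 = 1%N -> ev1 (c i) = 0}.
  move=> i si wi.
  (* The sign is there because the coordinate fixed by the reflection is minus the invariant, for
     instance - a - 2b for t^(a, b) s1. *)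
  apply: (int_sum_eq0 s_uniq si (rel1 _ (line_trace_tracelike (- (class_inv (w i)).2.1)))).
    rewrite ev1_line_trace !big_cons big_nil; move: wi.
    by case: (w i) => u [a b]; case: u => //= _; case: eqP => //; lia.
  move=> j sj ji; have [j0|j0] := eqVneq (class_inv (w j)).1 0%N; first by left; apply: c0.
  right; have : class_inv (w j) != class_inv (w i) by apply: contra_neq ji; apply: w_inj.
  rewrite ev1_line_trace !big_cons big_nil; move: wi j0.
  case: (w i) => u [a b]; case: (w j) => u' [a' b']; case: u => //= _; case: u' => //= _;
    by rewrite !xpair_eqE; case: eqP => //; lia.
move=> i si; have [i0|i0] := eqVneq (class_inv (w i)).1 0%N; first exact: c0.
have [i1|i1] := eqVneq (class_inv (w i)).1 1%N; first exact: c1.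
apply: (int_sum_eq0 s_uniq si (rel1 _ (component_trace_tracelike (class_inv (w i)).2.1))).
  rewrite /component_trace; move: i0 i1; case: (w i) => u [a b].
  by case: u => //= _ _; rewrite eqxx rmorphXn /= ev1_v expr1n.
move=> j sj ji; have [j0|j0] := eqVneq (class_inv (w j)).1 0%N; first by left; apply: c0.
have [j1|j1] := eqVneq (class_inv (w j)).1 1%N; first by left; apply: c1.
right; have : class_inv (w j) != class_inv (w i) by apply: contra_neq ji; apply: w_inj.
rewrite /component_trace; move: i0 i1 j0 j1.
case: (w i) => u [a b]; case: (w j) => u' [a' b']; case: u => //= _ _; case: u' => //= _ _;
  by rewrite !xpair_eqE eqxx andbT /= => /negPf ->; rewrite rmorph0.
Qed.

Lemma trace_independence (c : I -> laurent) :
    (forall phi, tracelike phi -> \sum_(i <- s) c i * phi (w i) = 0) ->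
  {in s, forall i, c i = 0}.
Proof.
move=> rel.
have dvd k : exists c' : I -> laurent, {in s, forall i, c i = (v - 1) ^+ k * c' i} /\
    (forall phi, tracelike phi -> \sum_(i <- s) c' i * phi (w i) = 0).
  elim: k => [|k [c' [cc' rel']]]; first by exists c; split=> // i _; rewrite mul1r.
  have dP i : exists y, i \in s -> c' i = (v - 1) * y.
    case: (boolP (i \in s)) => si; last by exists 0.
    by have [y ->] := ev1_eq0 (trace_independence_ev1 rel' si); exists y.
  pose d i := projT1 (cid (dP i)).
  have dE : {in s, forall i, c' i = (v - 1) * d i}.
    by move=> i si; rewrite /d; case: cid => y /= ->.
  exists d; split=> [i si|phi tphi]; first by rewrite cc' // dE // exprSr mulrA.
  apply: subv1_inj; rewrite mulr0 -[RHS](rel' _ tphi) mulr_sumr.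
  by apply: eq_big_seq => i si; rewrite mulrA dE.
move=> i si; apply/eqP; apply: contraT => /subv1_order[k [y [ey /negP]]]; case.
have [c' [cc' _]] := dvd k.+1.
have -> : y = (v - 1) * c' i.
  by apply: (@subv1_exp_inj k); rewrite -ey cc' // exprSr mulrA.
by rewrite rmorphM rmorphB rmorph1 /= ev1_v subrr mul0r.
Qed.

End Independence.

(** * Reduction to minimal length *)

Section ClassExpansion.

Variables (H : algType laurent) (T : extaff -> H).
Hypothesis hT : is_hecke_algebra T.

Let t e := T (enc e).

Definition congr_elt e e' : Prop := congr_comm (t e) (t e').

Lemma congr_elt_trans e2 e1 e3 : congr_elt e1 e2 -> congr_elt e2 e3 -> congr_elt e1 e3.
Proof. exact: congr_trans. Qed.

Lemma congr_elt_sym e1 e2 : congr_elt e1 e2 -> congr_elt e2 e1.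
Proof. exact: congr_sym. Qed.

Lemma congr_elt_refl e : congr_elt e e.
Proof. exact: congr_refl. Qed.
Hint Resolve congr_elt_refl : core.

Lemma congr_cj i e e' : cj i e = e' -> wlen e' = wlen e -> congr_elt e e'.
Proof. by move=> <-; apply: hecke_conj_eq. Qed.

Lemma congr_cjtau e e' : cjtau e = e' -> congr_elt e e'.
Proof. by move=> <-; apply: hecke_conj_tau. Qed.

(** This replaces the well-definedness of T_O: it is proved below for all translations, for
    reflection classes with nonzero invariant and for the class of s1 s2. *)
Definition stable e : Prop := forall e', class_inv e' = class_inv e ->
  (wlen e <= wlen e')%N /\ (wlen e' = wlen e -> congr_elt e e').

Lemma stable_eq e e' : stable e -> class_inv e' = class_inv e -> wlen e' = wlen e -> stable e'.
Proof.
move=> se ie le x; rewrite ie => ix; have [l c] := se x ix.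
rewrite le; split=> // xe; apply: (@congr_elt_trans e); last exact: c.
by apply: congr_elt_sym; have [_] := se e' ie; apply.
Qed.

(** All translations in a W-orbit have the same length, so s1 and s2 conjugate t^x to its dominant
    representative without changing the length. *)
Lemma stable_translation a b : stable (We, (a, b)).
Proof.
have cjP i a' b' : i != N0 -> congr_elt (We, (a', b')) (cj i (We, (a', b'))).
  by move=> i0; apply: (congr_cj erefl); case: i i0 => //= _; lia.
have dom a' b' : 0 <= a' -> 0 <= b' ->
    congr_elt (We, (a', b')) (canon (class_inv (We, (a', b')))).
  move=> a0 b0; rewrite (_ : canon _ = (We, (a', b'))); first exact: congr_elt_refl.
  by rewrite /=; congr (_, (_, _)); lia.
have red i a' b' : i != N0 ->
    congr_elt (cj i (We, (a', b'))) (canon (class_inv (cj i (We, (a', b'))))) ->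
    congr_elt (We, (a', b')) (canon (class_inv (We, (a', b')))).
  by move=> i0; rewrite inv_cj; apply: congr_elt_trans; apply: cjP.
have half a' b' : 0 <= a' + b' -> 0 <= b' ->
    congr_elt (We, (a', b')) (canon (class_inv (We, (a', b')))).
  move=> a0 b0; case: (lerP 0 a') => a1; first exact: dom.
  by apply: (red N1) => //; apply: dom; lia.
have anti a' b' : 0 <= a' + b' ->
    congr_elt (We, (a', b')) (canon (class_inv (We, (a', b')))).
  move=> a0; case: (lerP 0 b') => b0; first exact: half.
  by apply: (red N2) => //; apply: dom; lia.
have all a' b' : congr_elt (We, (a', b')) (canon (class_inv (We, (a', b')))).
  case: (lerP 0 (a' + b')) => ab; first exact: anti.
  case: (lerP 0 a') => a0.
    by apply: (red N2) => //; apply: (red N1) => //; apply: anti; lia.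
  by apply: (red N1) => //; apply: (red N2) => //; apply: anti; lia.
case=> u [x y]; case: u => // e; split=> [|_].
  by case: e => /=; lia.
apply: (congr_elt_trans (all a b)); rewrite -e.
by apply: congr_elt_sym; apply: all.
Qed.

(** Let n = x + 2k. For odd n the minimal length is reached once for each of the three reflections;
    for even nonzero n it is reached twice for each. Length-preserving conjugations link these three
    or six elements. At n = 0 the second one is no longer minimal: t^(2, -1) s1 has length 3. *)
Lemma stable_reflection (x k : int) : 0 <= x <= 1 -> x + 2 * k != 0 -> stable (W1, (x, k)).
Proof.
move=> x01 n0; have {x01} [xE|xE] : x = 0 \/ x = 1 by lia.
- subst x.
  have c1 : congr_elt (W1, (0, k)) (W121, (k, - k)).
    by apply: (@congr_cj N2) ; rewrite /cj /=; [congr (_, (_, _))|]; lia.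
  have c2 : congr_elt (W1, (0, k)) (W2, (- k, 0)).
    apply: (congr_elt_trans c1).
    by apply: (@congr_cj N1) ; rewrite /cj /=; [congr (_, (_, _))|]; lia.
  have c3 : congr_elt (W1, (0, k)) (W2, (- 1 - k, 2)).
    by apply: (@congr_cj N0) ; rewrite /cj /=; [congr (_, (_, _))|]; lia.
  have c4 : congr_elt (W1, (0, k)) (W121, (1 + k, 1 - k)).
    apply: (congr_elt_trans c3).
    by apply: (@congr_cj N1) ; rewrite /cj /=; [congr (_, (_, _))|]; lia.
  have c5 : congr_elt (W1, (0, k)) (W1, (2, k - 1)).
    apply: (congr_elt_trans c4).
    by apply: (@congr_cj N2) ; rewrite /cj /=; [congr (_, (_, _))|]; lia.
  case=> u [a b]; case: u => // -[e]; rewrite /wlen; split; try lia; move=> l.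
  + have [aE|aE] : a = 0 \/ a = 2 by lia.
      by rewrite aE; have -> : b = k by lia.
    by rewrite aE; have -> : b = k - 1 by lia.
  + have [bE|bE] : b = 0 \/ b = 2 by lia.
      by rewrite bE; have -> : a = - k by lia.
    by rewrite bE; have -> : a = - 1 - k by lia.
  + have [bE|bE] : a = k \/ a = 1 + k by lia.
      by rewrite bE; have -> : b = - k by lia.
    by rewrite bE; have -> : b = 1 - k by lia.
- subst x.
  have c1 : congr_elt (W1, (1, k)) (W121, (1 + k, - k)).
    by apply: (@congr_cj N2) ; rewrite /cj /=; [congr (_, (_, _))|]; lia.
  have c2 : congr_elt (W1, (1, k)) (W2, (- 1 - k, 1)).
    apply: (congr_elt_trans c1).
    by apply: (@congr_cj N1) ; rewrite /cj /=; [congr (_, (_, _))|]; lia.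
  case=> u [a b]; case: u => // -[e]; rewrite /wlen; split; try lia; move=> l.
  + have -> : a = 1 by lia.
    by have -> : b = k by lia.
  + have -> : a = - 1 - k by lia.
    by have -> : b = 1 by lia.
  + have -> : a = 1 + k by lia.
    by have -> : b = - k by lia.
Qed.

(** The minimal elements are the six products of two distinct simple reflections; [tau] permutes
    each cyclic triple, and s1 takes s1 s2 to s2 s1. *)
Lemma stable_elliptic : stable (W12, (0, 0)).
Proof.
have c1 : congr_elt (W12, (0, 0)) (W12, (1, 1)) by apply: congr_cjtau.
have c2 : congr_elt (W12, (0, 0)) (W12, (2, - 1)).
  by apply: (congr_elt_trans c1); apply: congr_cjtau.
have d0 : congr_elt (W12, (0, 0)) (W21, (0, 0)) by apply: (@congr_cj N1).
have d1 : congr_elt (W12, (0, 0)) (W21, (- 1, 2)).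
  by apply: (congr_elt_trans d0); apply: congr_cjtau.
have d2 : congr_elt (W12, (0, 0)) (W21, (1, 1)).
  by apply: (congr_elt_trans d1); apply: congr_cjtau.
case=> u [a b]; case: u => // -[e]; rewrite /wlen; split; try lia; move=> l.
- have [aE|[aE|aE]] : a = 0 \/ a = 1 \/ a = 2 by lia.
  + by rewrite aE; have -> : b = 0 by lia.
  + by rewrite aE; have -> : b = 1 by lia.
  + by rewrite aE; have -> : b = - 1 by lia.
- have [aE|[aE|aE]] : a = 0 \/ a = 1 \/ a = - 1 by lia.
  + by rewrite aE; have -> : b = 0 by lia.
  + by rewrite aE; have -> : b = 1 by lia.
  + by rewrite aE; have -> : b = 2 by lia.
Qed.

(* [F k] is the coefficient of the conjugacy class with invariant [k]. *)
Definition expands e (F : nat * (int * int) -> laurent) : Prop :=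
  exists s : seq (laurent * (weyl * (int * int))),
  [/\ {in s, forall p, stable p.2}, congr_comm (t e) (\sum_(p <- s) p.1 *: t p.2) &
      forall e', F (class_inv e') = \sum_(p <- s | class_inv p.2 == class_inv e') p.1].

Lemma expands_congr e e' F : congr_elt e e' -> expands e' F -> expands e F.
Proof.
move=> ee [s [st ce Fs]]; exists s; split=> //.
exact: congr_trans ee ce.
Qed.

Lemma expands_ext e F G :
  (forall e', G (class_inv e') = F (class_inv e')) -> expands e F -> expands e G.
Proof. by move=> FG [s [st ce Fs]]; exists s; split=> // e'; rewrite FG. Qed.

Lemma expands_stable e : stable e -> expands e (fun k => (k == class_inv e)%:R).
Proof.
move=> se; exists [:: (1, e)]; split.
- by move=> p; rewrite inE => /eqP ->.
- by rewrite big_seq1 scale1r; apply: congr_refl.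
- by move=> e'; rewrite big_mkcond big_seq1 /= eq_sym; case: eqP.
Qed.

Lemma expands_add e e1 e2 F1 F2 : congr_comm (t e) (t e1 + q *: t e2) ->
  expands e1 F1 -> expands e2 F2 -> expands e (fun k => F1 k + q * F2 k).
Proof.
move=> ce [s1 [st1 c1 E1]] [s2 [st2 c2 E2]].
exists (s1 ++ [seq (q * p.1, p.2) | p <- s2]); split.
- move=> p; rewrite mem_cat => /orP[/st1//|/mapP[p' /st2 sp ->]].
  exact: sp.
- apply: congr_trans ce _; rewrite big_cat big_map; apply: congrD => //.
  under eq_bigr do rewrite -scalerA.
  by rewrite -scaler_sumr; apply: congrZ.
- by move=> e'; rewrite big_cat big_map /= E1 E2 mulr_sumr.
Qed.

Lemma expands_down i e F1 F2 : wlen e = (wlen (cj i e)).+2 ->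
  expands (cj i e) F1 -> expands (lmul i e) F2 -> expands e (fun k => F1 k + q * F2 k).
Proof. by move=> l; apply: expands_add; apply: hecke_conj_down. Qed.

(* A class invariant (0, (p, r)) belongs to the translation by the dominant
   ((2p + r) / 3, (- p - 2r) / 3); it lies in Q iff 3 divides p and r, and it is
   then p/3 alpha1 - r/3 alpha2. *)
Definition refl1_coef (a b : int) (k : nat * (int * int)) : laurent :=
  match k with
  | (0%N, (p, r)) => if [&& p == 2 * a + b - 3, (3 %| r + a + 2 * b)%Z,
      - r <= a + 2 * b - 3, 3 <= 2 * p + r & 3 <= - p - 2 * r] then q else 0
  | (1%N, (n, _)) => (n == 3 - 2 * a - b)%:R
  | _ => 0
  end.

Definition refl2_coef (a b : int) (k : nat * (int * int)) : laurent :=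
  match k with
  | (0%N, (p, r)) => if [&& r == 3 - a - 2 * b, (3 %| p - 2 * a - b)%Z,
      p <= 2 * a + b - 3, 3 <= 2 * p + r & 3 <= - p - 2 * r] then q else 0
  | (1%N, (n, _)) => (n == a + 2 * b - 3)%:R
  | _ => 0
  end.

Lemma if_addl (c c' d : bool) (x y z : laurent) : y * z = x -> c = c' || d -> ~~ (c' && d) ->
  (if c then x else 0) = (if c' then x else 0) + y * (if d then z else 0).
Proof. by move=> <- ->; case: c'; case: d => //= _; rewrite ?mulr0 ?addr0 ?add0r. Qed.

Lemma natr_if (c : bool) : c%:R = if c then 1 else 0 :> laurent.
Proof. by case: c. Qed.

Lemma refl1_coef_base a b e' : 2 <= a -> 0 <= b <= 1 ->
  refl1_coef a b (class_inv e') = (class_inv e' == class_inv (W1, (1 - b, 1 - a)))%:R.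
Proof.
by move=> a2 b0; case: e' => -[] [x y] /=; rewrite ?xpair_eqE ?eqxx ?andbT //=;
  try (congr ((nat_of_bool _)%:R); lia); rewrite ifF //; lia.
Qed.

Lemma refl1_coef_step a b e' : 2 <= a -> 2 <= b -> refl1_coef a b (class_inv e') =
  refl1_coef (a + 1) (b - 2) (class_inv e') +
  q * (class_inv e' == class_inv (We, (b - 1, 2 - a - b)))%:R.
Proof.
move=> a2 b2; case: e' => -[] [x y] /=; rewrite ?xpair_eqE ?andFb ?mulr0 ?addr0 //=;
  try (congr ((nat_of_bool _)%:R); lia).
by rewrite natr_if; apply: if_addl; rewrite ?mulr1 //; lia.
Qed.

(** The translation split off has dominant representative (a - 1, b - 1), that is lambda - alpha1 -
    alpha2, regular when a, b >= 2. The recursion ends at b <= 1, where the reflection has minimal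
    length. *)
Lemma expands_refl1 (a b : int) : 2 <= a -> 0 <= b ->
  expands (W1, (1 - b, 1 - a)) (refl1_coef a b).
Proof.
move=> a2 b0; have [n bn] : exists n, b = n%:Z by exists (absz b); lia.
move: a b bn a2 {b0}; have [m] := ubnP n; elim: m n => // m IH n nm a b bn a2.
have [b1|b2] := lerP b 1.
  have st : stable (W1, (1 - b, 1 - a)) by apply: stable_reflection; lia.
  by apply: expands_ext (expands_stable st) => e'; apply: refl1_coef_base; lia.
apply: (@expands_ext _ (fun k => refl1_coef (a + 1) (b - 2) k +
    q * (k == class_inv (We, (b - 1, 2 - a - b)))%:R)); first by move=> e'; apply: refl1_coef_step.
apply: (@expands_down N1); first by rewrite /cj /=; lia.
  have -> : cj N1 (W1, (1 - b, 1 - a)) = (W1, (b - 1, 2 - a - b)).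
    by rewrite /cj /=; congr (_, (_, _)); lia.
  apply: (@expands_congr _ (W1, (1 - (b - 2), 1 - (a + 1)))); last first.
    by apply: (IH (absz (b - 2))); lia.
  (* Conjugating by s0 and then by [tau] restores the original shape, with lambda replaced by lambda
     - alpha2 = (a + 1, b - 2). *)
  pose e1 := cj N0 (W1, (b - 1, 2 - a - b)).
  apply: (@congr_elt_trans e1); first by apply: (@congr_cj N0); rewrite // /e1 /cj /=; lia.
  by apply: congr_cjtau; rewrite /e1 /cj /cjtau /=; congr (_, (_, _)); lia.
have -> : lmul N1 (W1, (1 - b, 1 - a)) = (We, (b - 1, 2 - a - b)).
  by rewrite /=; congr (_, (_, _)); lia.
by apply: expands_stable; apply: stable_translation.
Qed.

Lemma refl2_coef_base a b e' : 2 <= b -> 0 <= a <= 1 ->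
  refl2_coef a b (class_inv e') = (class_inv e' == class_inv (W2, (1 - b, 1 - a)))%:R.
Proof.
by move=> a2 b0; case: e' => -[] [x y] /=; rewrite ?xpair_eqE ?eqxx ?andbT //=;
  try (congr ((nat_of_bool _)%:R); lia); rewrite ifF //; lia.
Qed.

Lemma refl2_coef_step a b e' : 2 <= a -> 2 <= b -> refl2_coef a b (class_inv e') =
  refl2_coef (a - 2) (b + 1) (class_inv e') +
  q * (class_inv e' == class_inv (We, (2 - a - b, a - 1)))%:R.
Proof.
move=> a2 b2; case: e' => -[] [x y] /=; rewrite ?xpair_eqE ?andFb ?mulr0 ?addr0 //=;
  try (congr ((nat_of_bool _)%:R); lia).
by rewrite natr_if; apply: if_addl; rewrite ?mulr1 //; lia.
Qed.

Lemma expands_refl2 (a b : int) : 2 <= b -> 0 <= a ->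
  expands (W2, (1 - b, 1 - a)) (refl2_coef a b).
Proof.
move=> b2 a0; have [n an] : exists n, a = n%:Z by exists (absz a); lia.
move: a b an b2 {a0}; have [m] := ubnP n; elim: m n => // m IH n nm a b an b2.
have [a1|a2] := lerP a 1.
  (* [stable_reflection] speaks of representatives with finite part s1, so stability is transferred
     from the one with the same invariant a + 2b - 3 and the same length. *)
  have [k [y [k01 ky st]]] : exists k y,
      [/\ class_inv (W2, (1 - b, 1 - a)) = class_inv (W1, (k, y)),
       wlen (W2, (1 - b, 1 - a)) = wlen (W1, (k, y)) & stable (W1, (k, y))].
    pose n' := a + 2 * b - 3.
    exists (n' %% 2)%Z, (n' %/ 2)%Z; split; last by apply: stable_reflection; rewrite /n'; lia.
      by rewrite /= /n'; congr (_, (_, _)); lia.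
    by rewrite /= /n'; lia.
  apply: expands_ext (expands_stable (stable_eq st k01 ky)) => e'.
  by apply: refl2_coef_base; lia.
apply: (@expands_ext _ (fun k => refl2_coef (a - 2) (b + 1) k +
    q * (k == class_inv (We, (2 - a - b, a - 1)))%:R)); first by move=> e'; apply: refl2_coef_step.
apply: (@expands_down N2); first by rewrite /cj /=; lia.
  have -> : cj N2 (W2, (1 - b, 1 - a)) = (W2, (2 - a - b, a - 1)).
    by rewrite /cj /=; congr (_, (_, _)); lia.
  apply: (@expands_congr _ (W2, (1 - (b + 1), 1 - (a - 2)))); last first.
    by apply: (IH (absz (a - 2))); lia.
  pose e1 := cj N0 (W2, (2 - a - b, a - 1)).
  apply: (@congr_elt_trans e1); first by apply: (@congr_cj N0); rewrite // /e1 /cj /=; lia.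
  apply: (@congr_elt_trans (cjtau e1)); first exact: congr_cjtau.
  by apply: congr_cjtau; rewrite /e1 /cj /cjtau /=; congr (_, (_, _)); lia.
have -> : lmul N2 (W2, (1 - b, 1 - a)) = (We, (2 - a - b, a - 1)).
  by rewrite /=; congr (_, (_, _)); lia.
by apply: expands_stable; apply: stable_translation.
Qed.

(** For lambda in Q and lambda - lambda' = i alpha1 + j alpha2, the bounds on p and r say i, j >= 1,
    and the last two inequalities say that lambda' is regular dominant. The reflection invariants n
    and - n run over multiples of 3 up to the same two bounds. *)
Definition coxeter_coef (a b : int) (k : nat * (int * int)) : laurent :=
  match k with
  | (0%N, (p, r)) => if [&& (3 %| p)%Z, (3 %| r)%Z, p <= 2 * a + b - 3,
      - r <= a + 2 * b - 3, 3 <= 2 * p + r & 3 <= - p - 2 * r] then q ^+ 2 else 0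
  | (1%N, (n, _)) => if (3 %| n)%Z && ((3 <= n <= a + 2 * b - 3) || (3 <= - n <= 2 * a + b - 3))
      then q else 0
  | (_, (j, _)) => (j == 0)%:R
  end.

(** Passing to lambda - alpha1 lowers the bound 2a + b - 3 by 3 and keeps the other. The multiples
    of 3 lost are the single slice p = 2a + b - 3, respectively - n = 2a + b - 3, which is what
    [refl1_coef] carries. *)
Lemma coxeter_coef_step1 a b e' : 2 <= a -> 0 <= b -> (3 %| a - b)%Z ->
  coxeter_coef a b (class_inv e') =
  coxeter_coef (a - 2) (b + 1) (class_inv e') + q * refl1_coef a b (class_inv e').
Proof.
move=> a2 b0 ab; case: e' => -[] [x y] /=; rewrite ?mulr0 ?addr0 //;
  rewrite ?natr_if; apply: if_addl; rewrite ?mulr1 //; lia.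
Qed.

Lemma coxeter_coef_step2 a b e' : 0 <= a -> 2 <= b -> (3 %| a - b)%Z ->
  coxeter_coef a b (class_inv e') =
  coxeter_coef (a + 1) (b - 2) (class_inv e') + q * refl2_coef a b (class_inv e').
Proof.
move=> a2 b0 ab; case: e' => -[] [x y] /=; rewrite ?mulr0 ?addr0 //;
  rewrite ?natr_if; apply: if_addl; rewrite ?mulr1 //; lia.
Qed.

Lemma coxeter_coef_base e' :
  coxeter_coef 1 1 (class_inv e') = (class_inv e' == class_inv (W12, (1, 1)))%:R.
Proof.
by case: e' => -[] [x y] /=; rewrite ?xpair_eqE ?eqxx ?andbT //=; rewrite ifF //; lia.
Qed.

Lemma expands_coxeter (a b : int) : (3 %| a - b)%Z ->
  (1 <= a -> 0 <= b -> expands (W12, (a, b)) (coxeter_coef a b)) /\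
  (0 <= a -> 1 <= b -> expands (W21, (a, b)) (coxeter_coef a b)).
Proof.
have [m] := ubnP (absz (a + b)); elim: m a b => // m IH a b abm ab3.
have step1 : 2 <= a -> 0 <= b -> expands (W12, (a, b)) (coxeter_coef a b).
  move=> a2 b0; apply: (@expands_ext _ (fun k => coxeter_coef (a - 2) (b + 1) k +
      q * refl1_coef a b k)); first by move=> e'; apply: coxeter_coef_step1.
  apply: (@expands_down N0); first by rewrite /cj /=; lia.
    have -> : cj N0 (W12, (a, b)) = (W21, (- b, 3 - a)).
      by rewrite /cj /=; congr (_, (_, _)); lia.
    have [IH1 IH2] : (1 <= a - 2 -> 0 <= b + 1 ->
        expands (W12, (a - 2, b + 1)) (coxeter_coef (a - 2) (b + 1))) /\
      (0 <= a - 2 -> 1 <= b + 1 ->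
        expands (W21, (a - 2, b + 1)) (coxeter_coef (a - 2) (b + 1))) by apply: IH; lia.
    have [a3|a3] := lerP 3 a.
      apply: expands_congr (IH1 _ _); [|lia..].
      pose e1 := cj N2 (W21, (- b, 3 - a)).
      apply: (@congr_elt_trans e1).
        by apply: (@congr_cj N2); rewrite // /e1 /cj /=; lia.
      by apply: congr_cjtau; rewrite /e1 /cj /cjtau /=; congr (_, (_, _)); lia.
    apply: expands_congr (IH2 _ _); [|lia..].
    by apply: congr_cjtau; rewrite /cjtau /=; congr (_, (_, _)); lia.
  have -> : lmul N0 (W12, (a, b)) = (W1, (1 - b, 1 - a)) by [].
  exact: expands_refl1.
have step2 : 0 <= a -> 2 <= b -> expands (W21, (a, b)) (coxeter_coef a b).
  move=> a0 b2; apply: (@expands_ext _ (fun k => coxeter_coef (a + 1) (b - 2) k +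
      q * refl2_coef a b k)); first by move=> e'; apply: coxeter_coef_step2.
  apply: (@expands_down N0); first by rewrite /cj /=; lia.
    have -> : cj N0 (W21, (a, b)) = (W12, (3 - b, - a)).
      by rewrite /cj /=; congr (_, (_, _)); lia.
    have [IH1 IH2] : (1 <= a + 1 -> 0 <= b - 2 ->
        expands (W12, (a + 1, b - 2)) (coxeter_coef (a + 1) (b - 2))) /\
      (0 <= a + 1 -> 1 <= b - 2 ->
        expands (W21, (a + 1, b - 2)) (coxeter_coef (a + 1) (b - 2))) by apply: IH; lia.
    have [b3|b3] := lerP 3 b.
      apply: expands_congr (IH2 _ _); [|lia..].
      pose e1 := cj N1 (W12, (3 - b, - a)).
      apply: (@congr_elt_trans e1).
        by apply: (@congr_cj N1); rewrite // /e1 /cj /=; lia.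
      apply: (@congr_elt_trans (cjtau e1)); first exact: congr_cjtau.
      by apply: congr_cjtau; rewrite /e1 /cj /cjtau /=; congr (_, (_, _)); lia.
    apply: expands_congr (IH1 _ _); [|lia..].
    apply: (@congr_elt_trans (cjtau (W12, (3 - b, - a)))); first exact: congr_cjtau.
    by apply: congr_cjtau; rewrite /cjtau /=; congr (_, (_, _)); lia.
  have -> : lmul N0 (W21, (a, b)) = (W2, (1 - b, 1 - a)) by [].
  exact: expands_refl2.
have sw1 : congr_elt (W12, (1, b)) (W21, (1, b)) \/ b < 1.
  have [b1|] := lerP 1 b; [left|by right].
  pose e1 := cj N0 (W12, (1, b)).
  apply: (@congr_elt_trans e1); first by apply: (@congr_cj N0); rewrite // /e1 /cj /=; lia.
  by apply: congr_cjtau; rewrite /e1 /cj /cjtau /=; congr (_, (_, _)); lia.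
have sw2 : congr_elt (W21, (a, 1)) (W12, (a, 1)) \/ a < 1.
  have [a1|] := lerP 1 a; [left|by right].
  pose e1 := cj N0 (W21, (a, 1)).
  apply: (@congr_elt_trans e1); first by apply: (@congr_cj N0); rewrite // /e1 /cj /=; lia.
  apply: (@congr_elt_trans (cjtau e1)); first exact: congr_cjtau.
  by apply: congr_cjtau; rewrite /e1 /cj /cjtau /=; congr (_, (_, _)); lia.
have base : expands (W12, (1, 1)) (coxeter_coef 1 1).
  apply: (@expands_ext _ (fun k => (k == class_inv (W12, (1, 1)))%:R) _ coxeter_coef_base).
  by apply: expands_stable; apply: (stable_eq stable_elliptic).
split=> a0 b0.
- have [a2|a1] := lerP 2 a; first exact: step1.
  have aE : a = 1 by lia.
  have [b2|b1] := lerP 2 b.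
    case: sw1 => [sw1|]; last lia.
    by move: (step2); rewrite aE => /(_ erefl b2); apply: expands_congr.
  (* The value b = 0 is excluded because 3 divides a - b. *)
  by rewrite aE; have -> : b = 1 by lia.
- have [b2|b1] := lerP 2 b; first exact: step2.
  have bE : b = 1 by lia.
  case: sw2 => [sw2|]; last lia.
  have [a2|a1] := lerP 2 a.
    by move: (step1 a2); rewrite bE => /(_ erefl); apply: expands_congr.
  have aE : a = 1 by lia.
  by move: sw2; rewrite aE bE => sw2; apply: expands_congr base.
Qed.

End ClassExpansion.

(** * Class polynomials *)

Lemma min_length_class O : conj_classes O -> exists g, min_length_elts O g.
Proof.
move=> [g _ gO]; have ex : exists n, `[< exists2 h, O h & len h = n >].
  by exists (len g); apply/asboolP; exists g => //; rewrite -gO; apply: conj_class_refl.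
case: (ex_minnP ex) => n /asboolP[h Oh hn] min; exists h; split=> // k Ok.
by rewrite hn; apply: min; apply/asboolP; exists k.
Qed.

Lemma class_len_eq O g : min_length_elts O g -> class_len O = len g.
Proof.
move=> [Og gmin]; rewrite /class_len; case: xgetP => [h _ [Oh hmin]|/(_ g)[]] //.
by apply/eqP; rewrite eqn_leq gmin // hmin.
Qed.

Lemma conj_classesP O g : conj_classes O -> O g -> O = conj_class g.
Proof. by move=> [h _ <-]; apply: conj_class_eq. Qed.

(** For one fixed choice of representatives, the difference of two expansions is a finite relation
    among them modulo commutators; every trace annihilates it. *)
Lemma class_polynomials_unique (H : algType laurent) (T : extaff -> H) g f1 f2 :
    is_hecke_algebra T -> class_polynomials T g f1 -> class_polynomials T g f2 ->
  forall O, conj_classes O -> f1 O = f2 O.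
Proof.
move=> hT [fin1 cp1] [fin2 cp2].
pose rep O := xget 1%g (min_length_elts O).
have repP O : conj_classes O -> min_length_elts O (rep O).
  move=> /min_length_class[h hO]; rewrite /rep.
  by case: xgetP => [x _ //|/(_ h)].
have /finite_seqP[s sE] : finite_set ([set O | conj_classes O /\ f1 O <> 0] `|`
    [set O | conj_classes O /\ f2 O <> 0]) by rewrite finite_setU.
have sub O : O \in undup s -> conj_classes O.
  by rewrite mem_undup => Os; have : [set` s] O by []; rewrite -sE => -[[]|[]].
have out O : conj_classes O -> O \notin undup s -> f1 O = 0 /\ f2 O = 0.
  rewrite mem_undup => cO /negP no.
  by split; apply: contrapT => ne; apply: no; have : [set` s] O; rewrite // -sE; [left|right].
have sumE f : (forall O, conj_classes O -> O \notin undup s -> f O = 0) ->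
    \sum_(O \in conj_classes) f O *: T (rep O) = \sum_(O <- undup s) f O *: T (rep O).
  move=> f0; rewrite (fsbigE (undup s)) ?undup_uniq //.
  - by rewrite big_seq_cond [RHS]big_seq; apply: eq_bigl => O; apply: andb_idr => /sub; rewrite inE.
  - by move=> O cO /(f0 O cO) ->; rewrite scale0r.
have := commutator_spanD (cp2 rep repP) (commutator_spanN (cp1 rep repP)).
rewrite !sumE; try by move=> O cO /(out O cO)[].
rewrite opprB [X in commutator_span X]addrC addrA subrK -sumrB => rel O cO.
have [Os|/(out O cO)[-> ->] //] := boolP (O \in undup s).
have rep_inj : {in undup s &, forall O1 O2,
    class_inv (dec (rep O1)) = class_inv (dec (rep O2)) -> O1 = O2}.
  move=> O1 O2 /sub c1 /sub c2 /conj_classP e.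
  have [m1 _] := repP _ c1; have [m2 _] := repP _ c2.
  rewrite (conj_classesP c1 m1) (conj_classesP c2 m2).
  exact: conj_class_eq.
have indep := trace_independence (undup_uniq s) rep_inj (c := fun X => f1 X - f2 X).
apply/subr0_eq; move: O {cO} Os; apply: indep => phi tphi.
have := @tracelike_commutator _ _ hT phi [seq (f1 X - f2 X, rep X) | X <- undup s] tphi.
rewrite !big_map; apply; rewrite (eq_bigr (fun X => f1 X *: T (rep X) - f2 X *: T (rep X))) //.
by move=> X _; rewrite scalerBl.
Qed.

Section Expansion.

Variables (H : algType laurent) (T : extaff -> H).
Hypothesis hT : is_hecke_algebra T.

Lemma stable_rep e g : stable T e -> min_length_elts (conj_class (enc e)) g ->
  congr_comm (T (enc e)) (T g).
Proof.
move=> st [/conj_classP]; rewrite encK => ie gmin; have [l c] := st _ (esym ie).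
rewrite -[g]decK; apply: c; apply/eqP; rewrite eqn_leq l -!len_enc decK andbT.
exact/gmin/conj_class_refl.
Qed.

(** Every choice of representatives must be handled here; stability lets each term be replaced by
    the chosen one, after grouping the terms by class. *)
Lemma expands_class_polynomials e F f : expands T e F ->
    (forall e', f (conj_class (enc e')) = F (class_inv e')) ->
  class_polynomials T (enc e) f.
Proof.
move=> [s [st ce Fs]] fF; pose w (p : laurent * (weyl * (int * int))) := conj_class (enc p.2).
have wE p e' : (w p == conj_class (enc e')) = (class_inv p.2 == class_inv e').
  apply/eqP/eqP => [we|ie]; last first.
    by apply: conj_class_eq; apply/conj_classP; rewrite !encK.
  have : w p (enc e') by rewrite we; apply: conj_class_refl.
  by move/conj_classP; rewrite !encK.
have cO O : conj_classes O -> exists e', O = conj_class (enc e').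
  by move=> [g _ <-]; exists (dec g); rewrite decK.
have fE O : conj_classes O -> f O = \sum_(p <- s | w p == O) p.1.
  by move=> /cO[e' ->]; rewrite fF Fs; apply: eq_bigl => p; rewrite wE.
pose r := undup (map w s).
have out O : conj_classes O -> O \notin r -> f O = 0.
  move=> cl; rewrite mem_undup => /mapP no; rewrite fE // big_seq_cond big_pred0 // => p.
  by apply/negP => /andP[ps /eqP wp]; apply: no; exists p.
split.
  apply: (@sub_finite_set _ _ [set` r]); last exact: finite_seq.
  move=> O [cl fO]; rewrite /=; apply: contrapT => /negP no; apply: fO.
  exact: out.
move=> rep repP; rewrite (fsbigE r) ?undup_uniq //; first last.
- by move=> O cl /(out O cl) ->; rewrite scale0r.
- by move=> O; rewrite /= mem_undup => /mapP[p _ ->]; exists (enc p.2).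
have sub : {subset map w s <= r} by move=> O; rewrite mem_undup.
have -> : \sum_(O <- r | O \in conj_classes) f O *: T (rep O) = \sum_(p <- s) p.1 *: T (rep (w p)).
  rewrite (sum_by_value _ (undup_uniq _) sub) big_seq_cond [RHS]big_seq.
  apply: eq_big => [O|O /andP[_]].
    apply: andb_idr; rewrite inE mem_undup => /mapP[p _ ->] /=; by exists (enc p.2).
  rewrite inE => /fE ->; rewrite scaler_suml.
  by apply: eq_bigr => p /eqP ->.
apply: congr_trans ce _.
elim: s st {Fs wE fE r out sub} => [|p s IH] st; first by rewrite !big_nil; apply: congr_refl.
rewrite !big_cons; apply: congrD; last by apply: IH => x xs; apply: st; rewrite inE xs orbT.
apply: congrZ; apply: stable_rep; first by apply: st; rewrite inE eqxx.
by apply: repP; exists (enc p.2).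
Qed.

Lemma expands_class_polynomialsP e F f f0 : expands T e F ->
    (forall e', f0 (conj_class (enc e')) = F (class_inv e')) ->
  class_polynomials T (enc e) f <-> forall O, conj_classes O -> f O = f0 O.
Proof.
move=> ex f0F; split=> [cp|ff0].
  exact: class_polynomials_unique hT cp (expands_class_polynomials ex f0F).
by apply: expands_class_polynomials ex _ => e'; rewrite ff0 //; exists (enc e').
Qed.

End Expansion.

(** * The index sets of the statement in terms of class invariants *)

Lemma reflection_min_length (x k : int) e : 0 <= x <= 1 ->
  class_inv e = class_inv (W1, (x, k)) -> (wlen (W1, (x, k)) <= wlen e)%N.
Proof. by move=> x01; case: e => -[] [a b] // [e]; rewrite /wlen; lia. Qed.

(** On t^(a, b) s1 the length is |a - 1| + |b| + |a + b| with a + 2b = n fixed; the residue a of n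
    modulo 2 attains the minimum. *)
Lemma class_len_reflection g (n : int) : class_inv (dec g) = (1%N, (n, 0)) ->
  class_len (conj_class g) = (absz n + (2 %| n)%Z)%N.
Proof.
move=> ig; pose e : weyl * (int * int) := (W1, ((n %% 2)%Z, (n %/ 2)%Z)).
have ie : class_inv e = (1%N, (n, 0)) by rewrite /=; congr (_, (_, _)); lia.
rewrite (@class_len_eq _ (enc e)); first by rewrite len_enc /=; lia.
split=> [|h]; rewrite conj_classP; first by rewrite encK ie.
rewrite ig -ie len_enc -[h]decK len_enc encK => ih.
by apply: reflection_min_length; [lia|].
Qed.

Definition le_coef (a b : int) (k : nat * (int * int)) : bool :=
  if k is (0%N, (p, r)) then [&& (3 %| p)%Z, (3 %| r)%Z, p <= 2 * a + b - 3,
      - r <= a + 2 * b - 3, 3 <= 2 * p + r & 3 <= - p - 2 * r] else false.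

Lemma le_coefP (a b : int) e : (3 %| a - b)%Z ->
  reflect (exists x y : int, [/\ class_inv e = class_inv (We, (x, y)), (3 %| x - y)%Z,
     1 <= x, 1 <= y & (2 * x + y <= 2 * a + b - 3) && (x + 2 * y <= a + 2 * b - 3)])
   (le_coef a b (class_inv e)).
Proof.
move=> ab; apply: (iffP idP) => [h|[x [y [-> xy x1 y1 le]]]]; last by rewrite /=; lia.
pose x := ((2 * (class_inv e).2.1 + (class_inv e).2.2) %/ 3)%Z.
pose y := ((- (class_inv e).2.1 - 2 * (class_inv e).2.2) %/ 3)%Z.
move: h; exists x, y; move: h; rewrite /x /y {x y}.
case: e => -[] [c d] //=; set p := Num.max _ _; set r := Num.min _ _.
(* The three pairings are congruent modulo 3, hence so are p and r, and the quotients defining x and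
   y are exact. *)
have pr : (3 %| 2 * p + r)%Z by lia.
by move=> h; split; [congr (_, (_, _))| | | |]; lia.
Qed.

Lemma root_latticeP (x y : int) : root_lattice (x, y) <-> (3 %| x - y)%Z.
Proof.
split=> [[k [l]]|xy]; first by rewrite coweight_comb => -[-> ->]; lia.
exists ((2 * x + y) %/ 3)%Z, ((x + 2 * y) %/ 3)%Z.
by rewrite coweight_comb; congr (_, _); lia.
Qed.

Lemma mulrn_coweight (x : coweight) n : x *+ n = (x.1 * n%:Z, x.2 * n%:Z).
Proof. by rewrite pmulrn mulrz_coweight. Qed.

(** The removed lines are spanned by 3 omega2, 3 omega1 and (3, -3); the last meets the dominant
    cone only at 0, so what remains there is the regular part. *)
Lemma Q_shP (x y : int) : 0 <= x -> 0 <= y ->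
  Q_sh (x, y) <-> [/\ (3 %| x - y)%Z, x != 0 & y != 0].
Proof.
move=> x0 y0; split=> [[/root_latticeP xy no]|[xy x1 y1]].
  split=> //; apply/eqP => z; apply: no.
  - exists (y %/ 3)%Z; apply: Or31; rewrite mulrz_coweight mulrn_coweight /=.
    by congr (_, _); lia.
  - exists (x %/ 3)%Z; apply: Or32; rewrite mulrz_coweight mulrn_coweight /=.
    by congr (_, _); lia.
split; first exact/root_latticeP.
by case=> k [] ; rewrite mulrz_coweight ?mulrn_coweight => -[]; lia.
Qed.

(** Write lambda - lambda' = i alpha1 + j alpha2. The order condition gives i >= 1 and j >= 0, and
    the excluded string is j = 0. For [D'_] the roles of i and j are exchanged, so both sets amount
    to i, j >= 1. *)
Lemma D_P (a b x y : int) : (3 %| a - b)%Z ->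
  D_ (a, b) (x, y) <-> [/\ (3 %| x - y)%Z, 1 <= x, 1 <= y
    & (2 * x + y <= 2 * a + b - 3) && (x + 2 * y <= a + 2 * b - 3)].
Proof.
move=> ab; split.
  case=> -[/root_latticeP xy [/= x0 y0] [i [j [_ e]]] no] /(Q_shP x0 y0)[_ x1 y1].
  move: e; rewrite !mulrn_coweight => -[e1 e2]; split=> //; try lia.
  have := no i.+1 erefl; have [jE|j0] := posnP j; last by move=> _; lia.
  by case; rewrite mulrn_coweight; apply: coweight_ext => /=; lia.
case=> xy x1 y1 le; split; last by apply/Q_shP; [lia..|split; lia].
split; [exact/root_latticeP|by split=> /=; lia| |].
  pose i := ((2 * (a - x) + (b - y)) %/ 3)%Z; pose j := (((a - x) + 2 * (b - y)) %/ 3)%Z.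
  exists (absz (i - 1)), (absz j).
  split; first by case; rewrite /i /j; lia.
  by rewrite /i /j !mulrn_coweight; apply: coweight_ext => /=; lia.
by move=> i i0; rewrite mulrn_coweight => -[]; lia.
Qed.

Lemma D'_P (a b x y : int) : (3 %| a - b)%Z ->
  D'_ (a, b) (x, y) <-> [/\ (3 %| x - y)%Z, 1 <= x, 1 <= y
    & (2 * x + y <= 2 * a + b - 3) && (x + 2 * y <= a + 2 * b - 3)].
Proof.
move=> ab; split.
  case=> -[/root_latticeP xy [/= x0 y0] [i [j [_ e]]] no] /(Q_shP x0 y0)[_ x1 y1].
  move: e; rewrite !mulrn_coweight => -[e1 e2]; split=> //; try lia.
  have := no j.+1 erefl; have [jE|j0] := posnP i; last by move=> _; lia.
  by case; rewrite mulrn_coweight; apply: coweight_ext => /=; lia.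
case=> xy x1 y1 le; split; last by apply/Q_shP; [lia..|split; lia].
split; [exact/root_latticeP|by split=> /=; lia| |].
  pose i := ((2 * (a - x) + (b - y)) %/ 3)%Z; pose j := (((a - x) + 2 * (b - y)) %/ 3)%Z.
  exists (absz i), (absz (j - 1)).
  split; first by case; rewrite /i /j; lia.
  by rewrite /i /j !mulrn_coweight; apply: coweight_ext => /=; lia.
by move=> i i0; rewrite mulrn_coweight => -[]; lia.
Qed.

Lemma O_tr_in (D : set coweight) (a b : int) e : (3 %| a - b)%Z ->
    (forall x y, D (x, y) <-> [/\ (3 %| x - y)%Z, 1 <= x, 1 <= y
      & (2 * x + y <= 2 * a + b - 3) && (x + 2 * y <= a + 2 * b - 3)]) ->
  (conj_class (enc e) \in [set O_tr mu | mu in D]) = le_coef a b (class_inv e).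
Proof.
move=> ab DP; apply/idP/(le_coefP _ ab); rewrite inE.
  move=> [[x y] /DP[xy x1 y1 le] ee]; exists x, y; split=> //.
  have : conj_class (enc e) (enc e) by apply: conj_class_refl.
  by rewrite -ee /O_tr mk_tr conj_classP !encK => ->.
move=> [x [y [ie xy x1 y1 le]]]; exists (x, y); first exact/DP.
by rewrite /O_tr mk_tr; apply: conj_class_eq; apply/conj_classP; rewrite !encK.
Qed.

Lemma O_2_in e : (conj_class (enc e) \in [set O_2]) = (class_inv e == (2, (0, 0))).
Proof.
apply/idP/eqP; rewrite inE /=.
  move=> ee; have : conj_class (enc e) (enc e) by apply: conj_class_refl.
  by rewrite ee O_2_inv /= encK.
by move=> ie; rewrite O_2_inv conj_class_inv ie.
Qed.

(** The class length |n| + [n even] takes equal values at 2k and 2k + 1 for k > 0, but it is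
    strictly increasing in |n| on multiples of 3. Comparing class lengths therefore amounts to
    comparing |n| with N or P. *)
Lemma C_in (x y : coweight) (N P : int) e : (3 %| N)%Z -> (3 %| P)%Z -> 0 < N -> 0 < P ->
    x.1 + 2 * x.2 = N -> 2 * y.1 + y.2 = P ->
  (conj_class (enc e) \in C_le x `|` C'_le y) =
  if class_inv e is (1%N, (n, _)) then (3 %| n)%Z && ((3 <= n <= N) || (3 <= - n <= P)) else false.
Proof.
move=> N3 P3 N0 P0 xN yP.
have lx : class_len (conj_class (tr x * s1)%g) = (absz N + (2 %| N)%Z)%N.
  by apply: class_len_reflection; rewrite tr_s1 encK; case: x xN => a b /= ->.
have ly : class_len (conj_class (tr y * s2)%g) = (absz P + (2 %| P)%Z)%N.
  rewrite (@class_len_reflection _ (- P)); first by lia.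
  by rewrite tr_s2 encK; case: y yP => a b /= ->.
have CE i e' : class_inv e' = (1%N, (3 * i%:Z, 0)) -> C_ i = conj_class (enc e').
  by move=> ie; rewrite C_inv conj_class_inv ie.
have C'E i e' : class_inv e' = (1%N, (- (3 * i%:Z), 0)) -> C'_ i = conj_class (enc e').
  by move=> ie; rewrite C'_inv conj_class_inv ie.
have ex (n : int) : exists e', class_inv e' = (1%N, (n, 0)).
  by exists (W1, (n, 0)); rewrite /=; congr (_, (_, _)); lia.
have cl e' (n : int) : class_inv e' = (1%N, (n, 0)) ->
    class_len (conj_class (enc e')) = (absz n + (2 %| n)%Z)%N.
  by move=> ie; apply: class_len_reflection; rewrite encK.
have self : conj_class (enc e) (enc e) by apply: conj_class_refl.
apply/idP/idP.
  rewrite inE => -[[i [i0 eC]]|[i [i0 eC]]].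
    have ie : class_inv e = (1%N, (3 * i%:Z, 0)) by move: self; rewrite eC C_inv /= encK.
    by rewrite -eC (cl _ _ ie) lx ie; lia.
  have ie : class_inv e = (1%N, (- (3 * i%:Z), 0)) by move: self; rewrite eC C'_inv /= encK.
  by rewrite -eC (cl _ _ ie) ly ie; lia.
case ie: (class_inv e) => [[|[|k]] [n z]] //.
have z0 : z = 0 by case: e ie {self} => -[] [a b] //= [].
move: ie; rewrite z0 => ie /andP[n3 /orP[]] nN; rewrite inE; [left|right].
  have ie' : class_inv e = (1%N, (3 * (absz (n %/ 3)%Z)%:Z, 0)).
    by rewrite ie; congr (_, (_, _)); lia.
  exists (absz (n %/ 3)%Z); split; [lia|by rewrite (CE _ _ ie')|].
  by rewrite (CE _ _ ie') (cl _ _ ie) lx; lia.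
have ie' : class_inv e = (1%N, (- (3 * (absz (n %/ 3)%Z)%:Z), 0)).
  by rewrite ie; congr (_, (_, _)); lia.
exists (absz (n %/ 3)%Z); split; [lia|by rewrite (C'E _ _ ie')|].
by rewrite (C'E _ _ ie') (cl _ _ ie) ly; lia.
Qed.

(** The coweights x and y enter only through one pairing each. Both pairs in the statement give the
    same values, since alpha1 pairs to zero with omega2 and alpha2 with omega1. *)
Lemma coxeter_coefE (D : set coweight) (x y : coweight) (a b : int) e :
    (3 %| a - b)%Z -> 3 < 2 * a + b -> 3 < a + 2 * b ->
    (forall x' y', D (x', y') <-> [/\ (3 %| x' - y')%Z, 1 <= x', 1 <= y'
      & (2 * x' + y' <= 2 * a + b - 3) && (x' + 2 * y' <= a + 2 * b - 3)]) ->
    x.1 + 2 * x.2 = a + 2 * b - 3 -> 2 * y.1 + y.2 = 2 * a + b - 3 ->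
  (if conj_class (enc e) \in [set O_tr mu | mu in D] then (v - vinv) ^+ 2
   else if conj_class (enc e) \in C_le x `|` C'_le y then v - vinv
   else if conj_class (enc e) \in [set O_2] then 1 else 0) = coxeter_coef a b (class_inv e).
Proof.
move=> ab a0 b0 DP xN yP; rewrite (O_tr_in _ ab DP) (C_in _ _ _ _ _ xN yP); [|lia..].
rewrite O_2_in; case: e => -[] [c d] //=; rewrite !xpair_eqE /= ?andbT.
all: by rewrite natr_if.
Qed.

Theorem proposition2p12 (H : algType laurent) (T : extaff -> H)
    (hT : is_hecke_algebra T) :
  (forall m n : int, 2 <= m -> m <= n -> n < 2 * m - 1 ->
    let lam := alpha1 *~ m + alpha2 *~ n in
    forall f : set extaff -> laurent,
      class_polynomials T (tr lam * s1 * s2)%g f <->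
      forall O : set extaff, conj_classes O ->
        f O = if O \in [set O_tr mu | mu in D_ lam] then (v - vinv) ^+ 2
              else if O \in C_le (lam - alpha1 - alpha2) `|` C'_le (lam - alpha1)
                   then v - vinv
              else if O \in [set O_2] then 1
              else 0)
  /\
  (forall m n : int, 2 <= m -> m < n -> n < 2 * m - 1 ->
    let lam := alpha1 *~ m + alpha2 *~ n in
    forall f : set extaff -> laurent,
      class_polynomials T (tr lam * s2 * s1)%g f <->
      forall O : set extaff, conj_classes O ->
        f O = if O \in [set O_tr mu | mu in D'_ lam] then (v - vinv) ^+ 2
              else if O \in C_le (lam - alpha2) `|` C'_le (lam - alpha1 - alpha2)
                   then v - vinv
              else if O \in [set O_2] then 1
              else 0).
Proof.
(* In fundamental coweights lambda = (2m - n, 2n - m), and the hypotheses make both coordinates at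
   least 2. *)
split=> m n m2 mn nm lam f; have lamE : lam = (2 * m - n, 2 * n - m) by apply: coweight_comb.
- have l3 : (3 %| (2 * m - n) - (2 * n - m))%Z by lia.
  rewrite tr_s1s2 lamE.
  apply: (expands_class_polynomialsP hT (F := coxeter_coef (2 * m - n) (2 * n - m))).
    by have [+ _] := expands_coxeter hT l3; apply; lia.
  by move=> e; apply: coxeter_coefE; rewrite //=; try lia; move=> x y; apply: D_P.
- have l3 : (3 %| (2 * m - n) - (2 * n - m))%Z by lia.
  rewrite tr_s2s1 lamE.
  apply: (expands_class_polynomialsP hT (F := coxeter_coef (2 * m - n) (2 * n - m))).
    by have [_ +] := expands_coxeter hT l3; apply; lia.
  by move=> e; apply: coxeter_coefE; rewrite //=; try lia; move=> x y; apply: D'_P.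
Qed.
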